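(* Let $\mathbb{P}_N=\mathbb{P}_N^{\theta,M_N}$ be the measures described in the context and suppose that $\lim_{N\to\infty}p_N=\lim_{N\to\infty}q_N=0$. Let $\mu_N(\vec\ell)=\frac1N\sum_{i=1}^N\delta(\ell_i/N)$, where $\vec\ell$ is distributed according to $\mathbb{P}_N$. Then $\mu_N$ converges weakly in probability to $\phi_V^{\theta,\mathsf{M}+\theta}$, in the sense that for any bounded real continuous function $f$ on $[0,\infty)$ the sequence of random variables $$\int_0^\infty f(x)\,\mu_N(dx)-\int_0^\infty f(x)\,\phi_V^{\theta,\mathsf{M}+\theta}(x)\,dx$$ converges to $0$ in probability.
   Context: Measures. For $\theta>0$, $N\in\mathbb{N}$, $M\in\mathbb{Z}_{\ge0}$ let $\mathbb{W}^{\theta,M}_N$ be the set of $(\ell_1,\dots,\ell_N)$ with $\ell_i=\lambda_i+(N-i)\theta$, where $M\ge\lambda_1\ge\cdots\ge\lambda_N\ge0$ are integers. Put $Q_\theta(x)=\frac{\Gamma(x+1)\Gamma(x+\theta)}{\Gamma(x)\Gamma(x+1-\theta)}$ and, for $\vec\ell\in\mathbb{W}^{\theta,M_N}_N$, $$\mathbb{P}_N^{\theta,M_N}(\vec\ell)=\frac1{Z_N}\prod_{1\le i<j\le N}Q_\theta(\ell_i-\ell_j)\prod_{i=1}^N\exp(-NV_N(\ell_i/N)),$$ with $Z_N$ the normalization constant. Assumptions. (1) $\theta>0$, $A_0\ge a_0>0$, $\mathsf{M}\in[a_0,A_0]$; $M_N\in\mathbb{Z}_{\ge0}$ and $0\le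 q_N\le1$ are sequences with $|N^{-1}M_N-\mathsf{M}|\le A_1q_N$ for some $A_1>0$. (2) $V_N$ is continuous on $I_N=[0,M_NN^{-1}+(N-1)N^{-1}\theta]$. $V$ is a continuous function on $I=[0,\mathsf{M}+\theta]$, extended to $[0,\infty)$ by $V(x)=V(\mathsf{M}+\theta)$ for $x\ge\mathsf{M}+\theta$. There are a sequence $p_N\ge0$ and constants $A_2,A_3,A_4>0$ with $|V_N(s)-V(s)|\le A_2p_N$ for $s\in I_N$, and $|V(s)|\le A_3$ for $s\in I$. $V$ is differentiable on $(0,\mathsf{M}+\theta)$ with $|V'(s)|\le A_4\left[1+|\log|s||+|\log|s-\mathsf{M}-\theta||\right]$ there. Equilibrium measure. For $s\in[\theta,\infty)$ let $\mathcal{A}^\theta_s$ be the set of $\phi\in L^1([0,s])$ with $0\le\phi\le\theta^{-1}$ a.e. and $\int_0^s\phi=1$. $\phi_V^{\theta,s}$ is the (known to exist) unique minimizer over $\mathcal{A}^\theta_s$ of $$I_V^\theta(\phi)=-\theta\iint\log|x-y|\phi(x)\phi(y)\,dx\,dy+\int V(x)\phi(x)\,dx.$$ *)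

(* Defs.v *)
From HB Require Import structures.
From mathcomp Require Import all_boot all_order all_algebra.
From mathcomp Require Import all_classical all_reals all_analysis.

Set Implicit Arguments.
Unset Strict Implicit.
Unset Printing Implicit Defensive.
Import Order.TTheory GRing.Theory Num.Theory.
Import numFieldNormedType.Exports.
Local Open Scope classical_set_scope.
Local Open Scope ring_scope.

(* Euler's integral: equal to the Gamma function for x > 0, which suffices, as
   the arguments occurring in Q theta x are positive for x >= theta, and the
   differences l_i - l_j with i < j are at least theta. *)
Definition Gamma (R : realType) (x : R) : R :=
  \int[lebesgue_measure]_(t in `]0%R, +oo[) (t `^ (x - 1) * expR (- t)).

Definition Q (R : realType) (theta x : R) : R :=
  (Gamma (x + 1) * Gamma (x + theta)) / (Gamma x * Gamma (x + 1 - theta)).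

(* A point l of W^{theta,M}_N is encoded by its partition
   M >= lambda_1 >= ... >= lambda_N >= 0, with parts indexed from 0. *)
Definition W (N M : nat) : {pred N.-tuple 'I_M.+1} :=
  [pred lam : N.-tuple 'I_M.+1 | sorted (fun a b : 'I_M.+1 => (b <= a)%N) lam].
Arguments W : clear implicits.

Definition ell (R : realType) (theta : R) (N M : nat)
    (lam : N.-tuple 'I_M.+1) (i : nat) : R :=
  (nth ord0 lam i : nat)%:R + (N - i.+1)%:R * theta.

Definition weight (R : realType) (theta : R) (V : R -> R) (N M : nat)
    (lam : N.-tuple 'I_M.+1) : R :=
  (\prod_(i < N) \prod_(j < N | (i < j)%N)
      Q theta (ell theta lam i - ell theta lam j)) *
  \prod_(i < N) expR (- (N%:R * V (ell theta lam i / N%:R))).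

Definition Z (R : realType) (theta : R) (V : R -> R) (N M : nat) : R :=
  \sum_(lam in W N M) weight theta V lam.

(* The probability under P_N^{theta,M}, with potential V, of the event E. *)
Definition Pr (R : realType) (theta : R) (V : R -> R) (N M : nat)
    (E : pred (N.-tuple 'I_M.+1)) : R :=
  \sum_(lam in W N M | E lam) (weight theta V lam / Z theta V N M).

Definition empirical (R : realType) (theta : R) (N M : nat)
    (lam : N.-tuple 'I_M.+1) : {measure set (measurableTypeR R) -> \bar R} :=
  mscale (N%:R^-1)%:nng
    (msum (fun i => \d_(ell theta lam i / N%:R : measurableTypeR R)) N).

(* Elements of L^1([0, s]) are represented by functions on R whose values
   outside [0, s] are ignored. *)
Definition admissible (R : realType) (theta s : R) (phi : R -> R) : Prop :=
  [/\ lebesgue_measure.-integrable `[0%R, s] (EFin \o phi),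
      {ae lebesgue_measure, forall x, x \in `[0%R, s] ->
         0 <= phi x <= theta^-1} &
      \int[lebesgue_measure]_(x in `[0%R, s]) phi x = 1].

(* ln 0 = 0 here, which only affects the integrand on the (null) diagonal. *)
Definition energy (R : realType) (theta : R) (V : R -> R) (s : R)
    (phi : R -> R) : R :=
  - theta * (\int[(@lebesgue_measure R \x @lebesgue_measure R)%E]_(z in
               `[0%R, s] `*` `[0%R, s])
                (ln `|z.1 - z.2| * phi z.1 * phi z.2)) +
  \int[lebesgue_measure]_(x in `[0%R, s]) (V x * phi x).

(* phi is the minimizer of the energy over the admissible functions, unique as
   an element of L^1([0, s]). *)
Definition unique_minimizer (R : realType) (theta : R) (V : R -> R) (s : R)
    (phi : R -> R) : Prop :=
  admissible theta s phi /\
  forall psi : R -> R, admissible theta s psi ->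
    energy theta V s phi <= energy theta V s psi /\
    (energy theta V s psi = energy theta V s phi ->
     {ae lebesgue_measure, forall x, x \in `[0%R, s] -> psi x = phi x}).

(* Main.v *)
Require Import Defs.
From HB Require Import structures.
From mathcomp Require Import all_boot all_order all_algebra.
From mathcomp Require Import all_classical all_reals all_analysis.
From mathcomp Require Import measurable_realfun zify ring lra.

Set Implicit Arguments.
Unset Strict Implicit.
Unset Printing Implicit Defensive.
Import Order.TTheory GRing.Theory Num.Theory.
Import numFieldNormedType.Exports.
Local Open Scope classical_set_scope.
Local Open Scope ring_scope.

(** Scale the particles to [x_i = l_i / N] and regard a configuration as the
   mean [g |-> 1/N \sum_i g (x_i)] ([emp]).  Since [Q theta x] equals
   [x ^ (2 theta)] up to a factor [exp (O (1 / x))] ([Q_asymptotics]),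
   and since [l_i - l_j >= theta (j - i)], the weight of a configuration is,
   up to a factor common to all configurations and a factor [exp (o (N^2))],
   equal to [exp (- N^2 E)], where [E] is the discrete analogue
   [config_energy] of the energy ([weight_energy]).  The theorem is then a
   large deviation upper bound at speed [N^2], for which the number
   [(M_N + 1)^N] of configurations is negligible ([entropy_bound]); it is
   enough to show two facts about the minimal energy [I], that of [phi].

   - Some configuration has energy at most [I + o(1)]
     ([good_configuration]): round the quantiles of [phi] to the lattice.
     The bound [phi <= 1 / theta] keeps the quantiles far enough apart.

   - Configurations whose integral of [f] differs from that of [phi] by more
     than [eps] have energy at least [I + d] for some fixed [d > 0]
     ([energy_gap]).  Otherwise the energies of a sequence of such
     configurations come arbitrarily close to [I] or below.  Along an
     ultrafilter their distribution functions converge at every point.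
     Particles being [theta / N] apart, the limit is Lipschitz of constant
     [1 / theta], hence has an admissible density ([ultra_density]), whose
     energy is at most [I].  By uniqueness of the minimizer this density is
     [phi] almost everywhere, which contradicts the distance [eps].

   Both facts rest on the convergence of the energies when the distribution
   functions converge ([config_energy_cvg]).  The logarithm is singular, so
   it is replaced by [ln (max |x - y| eta)], a Lipschitz kernel, for which
   convergence is elementary ([mean2_cvg]); the replacement costs [O (eta)],
   uniformly over configurations ([sum_ln_dist]) as over densities bounded by
   [1 / theta] ([energy_lnmax]). *)


(** * Asymptotics of the interaction: quotients of Gamma functions *)

Section GammaFunction.
Variable R : realType.
Implicit Types x y u t c : R.
Local Notation mu := (@lebesgue_measure R).

Definition gammaf x t : R := t `^ (x - 1) * expR (- t).

Lemma gammaf_ge0 x t : 0 <= gammaf x t.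
Proof. by rewrite mulr_ge0 ?powR_ge0 ?expR_ge0. Qed.

Lemma gammafE x t : 0 < t -> gammaf x t = expR ((x - 1) * ln t - t).
Proof.
move=> t0; rewrite /gammaf expRD; congr (_ * _).
by rewrite /powR gt_eqF.
Qed.

Lemma measurable_gammaf x (D : set R) : measurable D -> measurable_fun D (gammaf x).
Proof.
move=> mD; apply: measurable_funTS; rewrite /gammaf.
apply: measurable_funM; first exact: measurable_powR.
apply: continuous_measurable_fun => t.
by apply: continuous_comp; [exact: opp_continuous|exact: continuous_expR].
Qed.

Lemma gammaf_derive x t : 0 < t ->
  is_derive t 1 (gammaf (x + 1)) (x * gammaf x t - gammaf (x + 1) t).
Proof.
move=> t0; rewrite /gammaf addrK.
have h1 := is_derive1_powR x t0.
apply: is_derive_eq.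
rewrite /GRing.scale/=; ring.
Qed.

Lemma gammaf_continuous x t : 0 < t -> {for t, continuous (gammaf x)}.
Proof.
move=> t0; apply: differentiable_continuous; apply/derivable1_diffP.
have := @gammaf_derive (x - 1) t t0; rewrite subrK.
by move=> h; exact: ex_derive.
Qed.

Lemma gammaf_within_continuous x (a b : R) : 0 < a ->
  {within `[a, b], continuous (gammaf x)}.
Proof.
move=> a0; apply: continuous_in_subspaceT => t.
rewrite inE/= in_itv/= => /andP[at_ _].
by apply: gammaf_continuous; apply: lt_le_trans at_.
Qed.

Lemma gammaf_integrable_cc x (a b : R) : 0 < a ->
  mu.-integrable `[a, b] (EFin \o gammaf x).
Proof.
move=> a0; apply: continuous_compact_integrable; first exact: segment_compact.
exact: gammaf_within_continuous.
Qed.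

(** Integration of the derivative of [gammaf (x + 1)], on a compact interval
   away from the singularity at 0. *)
Lemma gammaf_int_parts x (a b : R) : 0 < a -> a < b ->
  (x%:E * \int[mu]_(t in `[a, b]) (gammaf x t)%:E =
   \int[mu]_(t in `[a, b]) (gammaf (x + 1) t)%:E +
   (gammaf (x + 1) b - gammaf (x + 1) a)%:E)%E.
Proof.
move=> a0 ab.
have i1 := @gammaf_integrable_cc x a b a0.
have i2 := @gammaf_integrable_cc (x + 1) a b a0.
have : (\int[mu]_(t in `[a, b]) (x * gammaf x t - gammaf (x + 1) t)%:E =
    (gammaf (x + 1) b)%:E - (gammaf (x + 1) a)%:E)%E.
  apply: continuous_FTC2 => //.
  - apply: continuous_in_subspaceT => t.
    rewrite inE/= in_itv/= => /andP[at_ _].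
    have t0 := lt_le_trans a0 at_.
    apply: cvgB; last exact: gammaf_continuous.
    by apply: cvgMr; exact: gammaf_continuous.
  - split.
    + move=> t; rewrite in_itv/= => /andP[at_ _].
      have := @gammaf_derive x t (lt_trans a0 at_).
      by move=> h; exact: ex_derive.
    + apply: cvg_at_right_filter; exact: gammaf_continuous.
    + apply: cvg_at_left_filter; apply: gammaf_continuous; exact: lt_trans ab.
  - move=> t; rewrite in_itv/= => /andP[at_ _].
    have h := @gammaf_derive x t (lt_trans a0 at_).
    by rewrite derive1E derive_val.
under eq_integral do rewrite EFinB EFinM.
rewrite integralB//=; last exact: integrableZl.
rewrite integralZl//= => h.
rewrite EFinB -h addeC subeK//.
exact: (integrable_fin_num _ i2).
Qed.

Lemma gammaf_integral_ge0 x (D : set R) : (0 <= \int[mu]_(t in D) (gammaf x t)%:E)%E.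
Proof. by apply: integral_ge0 => t _; rewrite lee_fin gammaf_ge0. Qed.

Let J (n : nat) : set R := `[n.+2%:R^-1, n.+2%:R].

Let JE : \bigcup_n J n = `]0, +oo[%classic.
Proof.
apply/seteqP; split => [t [n _]|t].
  rewrite /J/= !in_itv/= andbT => /andP[h _].
  by apply: lt_le_trans h; rewrite invr_gt0 ltr0n.
rewrite /= in_itv/= andbT => t0.
have h0 : 0 <= t + t^-1 by rewrite addr_ge0 ?invr_ge0 ?ltW.
exists (Num.bound (t + t^-1)) => //.
have h := archi_boundP h0.
have t'0 : 0 < t^-1 by rewrite invr_gt0.
have h2 : (Num.bound (t + t^-1))%:R <= (Num.bound (t + t^-1)).+2%:R :> R by rewrite ler_nat ltnW.
rewrite /J/= in_itv/=; apply/andP; split; last by lra.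
rewrite -[leRHS]invrK lef_pV2 ?posrE ?ltr0n//; lra.
Qed.

Let gammaf_cvg x : (\int[mu]_(t in J n) (gammaf x t)%:E)%E @[n --> \oo] -->
  (\int[mu]_(t in `]0%R, +oo[) (gammaf x t)%:E)%E.
Proof.
rewrite -JE; apply: ge0_nondecreasing_set_cvg_integral.
- move=> m n mn; apply/subsetPset => t; rewrite /J/= !in_itv/= => /andP[h1 h2].
  apply/andP; split.
    by apply: le_trans h1; rewrite lef_pV2 ?posrE ?ltr0n// ler_nat !ltnS.
  by apply: (le_trans h2); rewrite ler_nat !ltnS.
- by move=> i; exact: measurable_itv.
- move=> i; apply/measurable_EFinP; apply: measurable_gammaf; exact: measurable_itv.
- by move=> i t _; rewrite lee_fin gammaf_ge0.
Qed.

Lemma gammaf_at0 x : 0 < x -> gammaf (x + 1) n.+2%:R^-1 @[n --> \oo] --> (0 : R).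
Proof.
move=> x0.
have : gammaf (x + 1) t @[t --> 0^'+] --> (0 : R).
  rewrite /gammaf addrK -[X in _ --> X](mul0r 1).
  apply: cvgM; first exact: powR_cvg0.
  rewrite -[X in _ --> X]expR0 -[X in expR X]oppr0.
  apply: continuous_cvg; first exact: continuous_expR.
  by apply: cvgN; apply: cvg_at_right_filter; exact: cvg_id.
move=> /cvg_at_rightP; apply; split.
  by move=> n; rewrite invr_gt0 ltr0n.
have := @cvg_harmonic R; rewrite -(cvg_shiftn 1)/= => h.
by under eq_fun => n do rewrite -addn1.
Qed.

(** The tangent of the logarithm at [2 x] absorbs the power into half of the
   exponential decay; the exponential distribution then serves as integrable
   majorant. *)
Lemma Gamma_bound x t : 0 < x -> 0 < t ->
  gammaf (x + 1) t <= expR (x * (ln (2 * x) - 1)) * expR (- (2^-1 * t)).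
Proof.
move=> x0 t0; rewrite gammafE// addrK -expRD ler_expR.
have h : ln (t / (2 * x)) <= t / (2 * x) - 1.
  have := @le_ln1Dx R (t / (2 * x) - 1).
  rewrite subrKC; apply; rewrite ltrBrDl subrr divr_gt0//; lra.
rewrite ln_div ?posrE ?mulr_gt0// in h.
have -> : ln t = (ln t - ln (2 * x)) + ln (2 * x) by ring.
have := ler_wpM2l (ltW x0) h.
have -> : x * (t / (2 * x) - 1) = t / 2 - x by field; rewrite gt_eqF.
lra.
Qed.

Lemma gammaf_atoo x : 0 < x -> gammaf (x + 1) n.+2%:R @[n --> \oo] --> (0 : R).
Proof.
move=> x0; pose C := expR (x * (ln (2 * x) - 1)).
have h t : 0 < t -> expR (- (2^-1 * t)) <= 2 / t.
  move=> t0; rewrite expRN -[leRHS]invf_div lef_pV2 ?posrE ?expR_gt0 ?divr_gt0// mulrC.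
  by apply: le_trans (expR_ge1Dx _); rewrite lerDr.
apply: (@squeeze_cvgr _ _ _ _ (cst 0) (fun n => C * 2 * n.+2%:R^-1)).
- near=> n; rewrite gammaf_ge0/=; apply: (le_trans (Gamma_bound _ _)); rewrite ?ltr0n//.
  by rewrite -mulrA; apply: ler_wpM2l; [exact: expR_ge0|apply: h; rewrite ltr0n].
- exact: cvg_cst.
- rewrite -[X in _ --> X](mulr0 (C * 2)); apply: cvgMr.
  have := @cvg_harmonic R; rewrite -(cvg_shiftn 1)/= => h1.
  by under eq_fun => n do rewrite -addn1.
Unshelve. all: by end_near. Qed.

(** The functional equation is first stated for integrals with values in the
   extended reals, so that it also yields the integrability of [gammaf x] for
   [0 < x < 1], where [gammaf x] is unbounded near 0. *)
Lemma Gamma_integral x : 0 < x ->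
  (x%:E * \int[mu]_(t in `]0%R, +oo[) (gammaf x t)%:E =
   \int[mu]_(t in `]0%R, +oo[) (gammaf (x + 1) t)%:E)%E.
Proof.
move=> x0.
have h1 : (x%:E * \int[mu]_(t in J n) (gammaf x t)%:E)%E @[n --> \oo] -->
   (x%:E * \int[mu]_(t in `]0%R, +oo[) (gammaf x t)%:E)%E.
  by apply: cvgeZl => //; exact: gammaf_cvg.
have h2 : (\int[mu]_(t in J n) (gammaf (x + 1) t)%:E +
   (gammaf (x + 1) n.+2%:R - gammaf (x + 1) n.+2%:R^-1)%:E)%E @[n --> \oo] -->
   (\int[mu]_(t in `]0%R, +oo[) (gammaf (x + 1) t)%:E + 0%:E)%E.
  apply: cvgeD; first by rewrite ge0_adde_def// inE ?gammaf_integral_ge0.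
    exact: gammaf_cvg.
  apply/cvg_EFin; first by near=> n.
  rewrite -[X in _ --> X](subrr 0).
  by apply: cvgB; [exact: gammaf_atoo|exact: gammaf_at0].
rewrite adde0 in h2.
apply: cvg_unique h1 _ => //.
rewrite (_ : (fun n => _) = (fun n => x%:E * \int[mu]_(t in J n) (gammaf x t)%:E)%E) in h2.
  exact: h2.
apply/funext => n; rewrite gammaf_int_parts//.
by rewrite (@lt_trans _ _ 1)// ?invf_lt1 ?ltr1n.
Unshelve. all: by end_near. Qed.

Lemma Gamma_integral_lty1 x : 0 < x ->
   (\int[mu]_(t in `]0%R, +oo[) (gammaf (x + 1) t)%:E < +oo)%E.
Proof.
move=> x0; pose C := expR (x * (ln (2 * x) - 1)).
pose p := exponential_pdf (2^-1 : R).
have ip : mu.-integrable setT (EFin \o p) by apply: integrable_exponential_pdf; rewrite invr_gt0.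
have ip2 : mu.-integrable `]0%R, +oo[ (fun t => (C * 2)%:E * (p t)%:E)%E.
  by apply: integrableZl => //; apply: integrableS ip.
apply: le_lt_trans (integrable_lty _ ip2) => //.
apply: ge0_le_integral => //.
- by move=> t _; rewrite lee_fin gammaf_ge0.
- by apply/measurable_EFinP; exact: measurable_gammaf.
- exact: (measurable_int _ ip2).
- move=> t; rewrite /= in_itv/= andbT => t0.
  rewrite -EFinM lee_fin (le_trans (Gamma_bound x0 t0))//.
  rewrite /p exponential_pdfE ?(ltW t0)//= mulNr.
  rewrite le_eqVlt; apply/orP; left; apply/eqP; rewrite /C; by field.
Qed.

Lemma Gamma_integral_lty x : 0 < x ->
   (\int[mu]_(t in `]0%R, +oo[) (gammaf x t)%:E < +oo)%E.
Proof.
move=> x0; have := Gamma_integral_lty1 x0; rewrite -Gamma_integral//.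
have h0 := gammaf_integral_ge0 x `]0%R, +oo[.
case E : (\int[mu]_(t in `]0%R, +oo[) (gammaf x t)%:E)%E => [r| |].
- by move=> _; rewrite ltry.
- by rewrite gt0_muley ?lte_fin.
- by rewrite E in h0.
Qed.

Lemma gammaf_integrable x : 0 < x -> mu.-integrable `]0%R, +oo[ (EFin \o gammaf x).
Proof.
move=> x0; apply/integrableP; split.
  by apply/measurable_EFinP; exact: measurable_gammaf.
under eq_integral do rewrite gee0_abs ?lee_fin ?gammaf_ge0//.
exact: Gamma_integral_lty.
Qed.

Let gammaf_integrableZ k x : 0 < x ->
  mu.-integrable `]0%R, +oo[ (EFin \o (fun t => k * gammaf x t)).
Proof.
by move=> x0; apply: (integrableZl _ k (gammaf_integrable x0)).
Qed.

Lemma Gammaf x : Gamma x = \int[mu]_(t in `]0%R, +oo[) gammaf x t.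
Proof. by []. Qed.

Lemma GammaS x : 0 < x -> Gamma (x + 1) = x * Gamma x.
Proof.
move=> x0; rewrite !Gammaf /Rintegral -Gamma_integral// fineM//.
exact: (integrable_fin_num _ (gammaf_integrable x0)).
Qed.

Lemma Gamma_gt0 x : 0 < x -> 0 < Gamma x.
Proof.
move=> x0; pose c : R := expR (- `|x - 1| - 2).
have h : \int[mu]_(t in `]0%R, +oo[) (c * \1_`[1, 2] t) <= Gamma x.
  rewrite Gammaf; apply: le_Rintegral => //.
  - have := @integrable_indic_itv R 1 2 true false.
    move=> /(integrableZl measurableT c) h; apply: integrableS h => //.
  - exact: gammaf_integrable.
  - move=> t; rewrite /= in_itv/= andbT => t0.
    rewrite indicE; case: (boolP (_ \in _)); rewrite ?mulr0 ?gammaf_ge0// mulr1.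
    rewrite inE/= in_itv/= => /andP[t1 t2].
    rewrite gammafE// ler_expR.
    have : `|(x - 1) * ln t| <= `|x - 1|.
      rewrite normrM ler_piMr// ger0_norm ?ln_ge0//.
      have := @le_ln1Dx R (t - 1); rewrite subrKC => /(_ _)/le_trans; apply; lra.
    rewrite ler_norml => /andP[h _]; lra.
apply: lt_le_trans h.
rewrite RintegralZl//; last first.
  by have := @integrable_indic_itv R 1 2 true false; apply: integrableS.
rewrite mulr_gt0 ?expR_gt0// /Rintegral integral_indic//.
have h1 : mu `[(1 : R), 2]%classic = 1%:E.
  by rewrite lebesgue_measure_itv/= lte_fin ltrDl ltr01/= -EFinB addrK.
rewrite [X in fine X](_ : _ = 1%:E)// -h1; congr (mu _).
apply/seteqP; split => t/=; first by case.
rewrite !in_itv/= andbT => /andP[h2 h3]; split; rewrite ?h2//; lra.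
Qed.

(** Convexity of a power, integrated against the Gamma density with
   parameter [y + u]: the tangent line at [t = y + u] leaves only the first
   two moments. *)
Lemma Gamma_upper y u : 0 < y -> 0 <= u ->
  Gamma (y + u) <= (y + u) `^ u * Gamma y.
Proof.
move=> y0 u0; set z := y + u.
have z0 : 0 < z by rewrite ltr_wpDr.
suff : (1 + u) * Gamma z - u / z * Gamma (z + 1) <= z `^ u * Gamma y.
  rewrite GammaS// mulrA divfK ?gt_eqF//; lra.
have zi := gammaf_integrable z0.
have z10 : 0 < z + 1 by rewrite addr_gt0.
have zi1 : mu.-integrable `]0%R, +oo[ (EFin \o gammaf (z + 1)).
  by apply: gammaf_integrable; rewrite addr_gt0.
have yi := gammaf_integrable y0.
have e1 := gammaf_integrableZ (1 + u) z0.
have e2 := gammaf_integrableZ (u / z) z10.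
have e3 := gammaf_integrableZ (z `^ u) y0.
rewrite !Gammaf -!RintegralZl// -RintegralB//.
apply: le_Rintegral => //; first exact: (integrableB _ e1 e2).
move=> t; rewrite /= in_itv/= andbT => t0.
have gy : gammaf y t = gammaf z t * t `^ (- u).
  rewrite /gammaf mulrAC -powRD; last by rewrite (gt_eqF t0) implybT.
  by congr (_ `^ _ * _); rewrite /z; ring.
have gz : gammaf (z + 1) t = gammaf z t * t.
  rewrite /gammaf addrK mulrAC; congr (_ * _).
  by rewrite -mulr_powRB1 ?ltW// mulrC.
rewrite gy gz.
have -> : (1 + u) * gammaf z t - u / z * (gammaf z t * t) =
  gammaf z t * (1 - u * (t / z - 1)) by field; rewrite gt_eqF.
rewrite mulrCA; apply: ler_wpM2l; first exact: gammaf_ge0.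
rewrite /powR !gt_eqF// -expRD.
apply: le_trans (expR_ge1Dx _).
rewrite -subr_ge0.
have -> : 1 + (u * ln z + - u * ln t) - (1 - u * (t / z - 1)) = u * ((t / z - 1) - ln (t / z)).
  by rewrite ln_div ?posrE//; ring.
rewrite mulr_ge0// subr_ge0.
have := @le_ln1Dx R (t / z - 1); rewrite subrKC; apply.
by rewrite ltrBrDl subrr divr_gt0.
Qed.

(** The same tangent argument at [t = y - 1], against the Gamma density with
   parameter [y - 1]: with this choice of the base point the first-order terms
   cancel. *)
Lemma Gamma_lower y u : 1 < y -> 0 <= u ->
  (y - 1) `^ u * Gamma y <= Gamma (y + u).
Proof.
move=> y1 u0; set c := y - 1.
have c0 : 0 < c by rewrite subr_gt0.
have y0 : 0 < y by apply: lt_trans y1.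
have gyc : Gamma y = c * Gamma c by rewrite -GammaS// /c subrK.
suff : c `^ u * (1 + u) * Gamma y - c `^ u * (u * c) * Gamma c <= Gamma (y + u).
  rewrite gyc; apply: le_trans; rewrite -subr_ge0.
  by rewrite le_eqVlt; apply/orP; left; apply/eqP; ring.
have ci := gammaf_integrable c0.
have yui : mu.-integrable `]0%R, +oo[ (EFin \o gammaf (y + u)).
  by apply: gammaf_integrable; rewrite ltr_wpDr.
have yi := gammaf_integrable y0.
have e1 := gammaf_integrableZ (c `^ u * (1 + u)) y0.
have e2 := gammaf_integrableZ (c `^ u * (u * c)) c0.
rewrite !Gammaf -!RintegralZl// -RintegralB//.
apply: le_Rintegral => //; first exact: (integrableB _ e1 e2).
move=> t; rewrite /= in_itv/= andbT => t0.
have gy : gammaf y t = gammaf c t * t.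
  have -> : y = c + 1 by rewrite /c subrK.
  rewrite /gammaf addrK mulrAC; congr (_ * _).
  by rewrite -mulr_powRB1 ?ltW// mulrC.
have gyu : gammaf (y + u) t = gammaf c t * (t * t `^ u).
  rewrite mulrA -gy /gammaf mulrAC -powRD; last by rewrite (gt_eqF t0) implybT.
  by congr (_ `^ _ * _); ring.
rewrite gy gyu.
have -> : c `^ u * (1 + u) * (gammaf c t * t) - c `^ u * (u * c) * gammaf c t =
  gammaf c t * (c `^ u * (t + u * (t - c))) by ring.
apply: ler_wpM2l; first exact: gammaf_ge0.
have -> : t `^ u = c `^ u * expR (u * ln (t / c)).
  by rewrite /powR !gt_eqF// -expRD ln_div ?posrE//; congr expR; ring.
rewrite mulrCA; apply: ler_wpM2l; first exact: powR_ge0.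
have := expR_ge1Dx (u * ln (t / c)).
move=> /(ler_wpM2l (ltW t0)); apply: le_trans.
rewrite [leRHS]mulrDr mulr1 lerD2l mulrCA; apply: ler_wpM2l => //.
have := @le_ln1Dx R (c / t - 1); rewrite subrKC => h.
have {}h : ln (c / t) <= c / t - 1 by apply: h; rewrite ltrBrDl subrr divr_gt0.
have -> : ln (t / c) = - ln (c / t) by rewrite -[t / c]invf_div lnV// posrE divr_gt0.
have := ler_wpM2l (ltW t0) h.
have -> : t * (c / t - 1) = c - t by field; rewrite gt_eqF.
lra.
Qed.

(* From here on only the functional equation, the positivity and the two
   bounds above are used. *)
Opaque Gamma.

Lemma lnGamma_bounds y u : 1 < y -> 0 <= u ->
  u * ln (y - 1) <= ln (Gamma (y + u)) - ln (Gamma y) <= u * ln (y + u).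
Proof.
move=> y1 u0; have y0 : 0 < y by apply: lt_trans y1.
have yu0 : 0 < y + u by rewrite ltr_wpDr.
have c0 : 0 < y - 1 by rewrite subr_gt0.
have G1 := Gamma_gt0 y0.
have G2 := Gamma_gt0 yu0.
move: (Gamma_lower y1 u0) (Gamma_upper y0 u0) G1 G2.
move: (Gamma y) (Gamma (y + u)) => g g' l1 l2 G1 G2.
rewrite -!ln_powR lerBrDr lerBlDr -!lnM ?posrE ?powR_gt0//.
by rewrite !ler_ln ?posrE ?mulr_gt0 ?powR_gt0// l1.
Qed.

Lemma ln_dist x y (k d : R) : 0 < k -> 0 < x -> k * x <= y -> k <= 1 -> `|y - x| <= d ->
  `|ln y - ln x| <= d / (k * x).
Proof.
move=> k0 x0 kxy k1 yx.
have kx0 : 0 < k * x by rewrite mulr_gt0.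
have y0 : 0 < y by apply: lt_le_trans kxy.
have aux a b : 0 < a -> 0 < b -> k * x <= b -> `|a - b| <= d -> ln a - ln b <= d / (k * x).
  move=> a0 b0 kb ab.
  have : ln (a / b) <= a / b - 1.
    by have := @le_ln1Dx R (a / b - 1); rewrite subrKC; apply; rewrite ltrBrDl subrr divr_gt0.
  rewrite ln_div ?posrE// => /le_trans; apply.
  have -> : a / b - 1 = (a - b) / b by field; rewrite gt_eqF.
  rewrite ler_pdivrMr// -mulrA.
  have ab' : a - b <= d by apply: le_trans (ler_norm _) ab.
  apply: (le_trans ab'); rewrite ler_peMr ?(le_trans _ ab)//.
  by rewrite ler_pdivlMl// mulr1.
rewrite ler_norml; apply/andP; split.
  rewrite lerNl opprB; apply: aux => //; by rewrite distrC.
by apply: aux => //; rewrite ger_pMl.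
Qed.

(** By the functional equation, [Q theta x] is
   [x (x + 1 - theta) / (x + theta)] times
   [Gamma (x + theta + 1) / Gamma (x + 2 - theta)], which keeps the last two
   arguments above 1, as [lnGamma_bounds] requires. That lemma
   encloses the logarithm of the quotient between [2 theta - 1] times the
   logarithms of two bounded shifts of [x], and such shifts cost only
   [O (1 / x)]. *)
Lemma Q_asymptotics theta : 0 < theta ->
  exists2 C : R, 0 <= C & forall x, theta <= x ->
    0 < Q theta x /\ `|ln (Q theta x) - 2 * theta * ln x| <= C / x.
Proof.
move=> th0; pose k := (1 + theta)^-1; pose d := 2 + theta.
have k0 : 0 < k by rewrite invr_gt0; lra.
have k1 : k <= 1 by rewrite invf_le1; lra.
exists (d / k * (2 + `|2 * theta - 1|)).
  by rewrite mulr_ge0// ?divr_ge0 ?addr_ge0// ltW.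
move=> x thx; have x0 : 0 < x by apply: lt_le_trans thx.
pose a := x + 1 - theta; pose b := x + theta.
have a1 : 1 <= a by rewrite /a; lra.
have b0 : 0 < b by rewrite /b; lra.
have a0 : 0 < a by lra.
have kxa : k * x <= a.
  rewrite /k ler_pdivrMl ?addr_gt0//.
  have : 0 <= theta * (x - theta) by rewrite mulr_ge0 ?subr_ge0// ltW.
  rewrite /a; lra.
have kx : k * x <= x by rewrite ger_pMl.
have da : `|ln a - ln x| <= d / (k * x).
  by apply: ln_dist => //; rewrite ler_norml /a /d; apply/andP; split; lra.
have da1 : `|ln (a + 1) - ln x| <= d / (k * x).
  by apply: ln_dist => //; [lra|rewrite ler_norml /a /d; apply/andP; split; lra].
have db : `|ln b - ln x| <= d / (k * x).
  by apply: ln_dist => //; [rewrite /b; lra|rewrite ler_norml /b /d; apply/andP; split; lra].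
have db1 : `|ln (b + 1) - ln x| <= d / (k * x).
  by apply: ln_dist => //; [rewrite /b; lra|rewrite ler_norml /b /d; apply/andP; split; lra].
have [Gx Ga Gb] := And3 (Gamma_gt0 x0) (Gamma_gt0 a0) (Gamma_gt0 b0).
have QE : Q theta x = (x * Gamma x * Gamma b) / (Gamma x * Gamma a).
  by rewrite /Q GammaS.
have gb : Gamma (b + 1) = b * Gamma b by rewrite GammaS.
have ga : Gamma (a + 1) = a * Gamma a by rewrite GammaS.
have Qpos : 0 < Q theta x.
  rewrite QE; move: (Gamma _) (Gamma a) (Gamma b) Gx Ga Gb => u v w u0 v0 w0.
  by rewrite divr_gt0 ?mulr_gt0.
split => //.
have ->: ln (Q theta x) = ln x - ln b + ln a + (ln (Gamma (b + 1)) - ln (Gamma (a + 1))).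
  rewrite QE gb ga; move: (Gamma _) (Gamma a) (Gamma b) Gx Ga Gb => u v w u0 v0 w0.
  rewrite ln_div ?posrE ?mulr_gt0// !lnM ?posrE ?mulr_gt0//; ring.
have -> : d / k * (2 + `|2 * theta - 1|) / x = (2 + `|2 * theta - 1|) * (d / (k * x)).
  by field; rewrite ?gt_eqF.
move: (d / (k * x)) da da1 db db1 => e da da1 db db1.
clear QE ga gb Qpos Gx Ga Gb.
have -> : ln x - ln b + ln a + (ln (Gamma (b + 1)) - ln (Gamma (a + 1))) -
    2 * theta * ln x = (ln a - ln x) - (ln b - ln x) + (ln (Gamma (b + 1)) -
      ln (Gamma (a + 1)) - (2 * theta - 1) * ln x) by ring.
suff h : `|ln (Gamma (b + 1)) - ln (Gamma (a + 1)) - (2 * theta - 1) * ln x| <=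
    `|2 * theta - 1| * e.
  apply: (le_trans (ler_normD _ _)); rewrite [leRHS]mulrDl; apply: lerD => //.
  by apply: (le_trans (ler_normB _ _)); lra.
(* The sign of [2 theta - 1] decides which of the two arguments is larger. *)
have [th|th] := leP (1 / 2) theta.
  have u0 : 0 <= 2 * theta - 1 by lra.
  have aa : 1 < a + 1 by lra.
  have := lnGamma_bounds aa u0; rewrite addrK.
  have -> : a + 1 + (2 * theta - 1) = b + 1 by rewrite /a /b; ring.
  rewrite (ger0_norm u0); move: (2 * theta - 1) u0 => u u0 /andP[h1 h2].
  move: da db1; rewrite !ler_norml => /andP[da _] /andP[_ db1].
  have := ler_wpM2l u0 da; have := ler_wpM2l u0 db1.
  move: (ln (Gamma _)) (ln (Gamma _)) h1 h2 => p q h1 h2.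
by move=> ? ?; apply/andP; split; lra.
have u0 : 0 <= 1 - 2 * theta by lra.
have bb : 1 < b + 1 by lra.
have := lnGamma_bounds bb u0; rewrite addrK.
have -> : b + 1 + (1 - 2 * theta) = a + 1 by rewrite /a /b; ring.
have -> : 2 * theta - 1 = - (1 - 2 * theta) by ring.
rewrite normrN (ger0_norm u0).
move: (1 - 2 * theta) u0 => u u0 /andP[h1 h2].
move: da1 db; rewrite !ler_norml => /andP[_ da1] /andP[db _].
have := ler_wpM2l u0 da1; have := ler_wpM2l u0 db.
move: (ln (Gamma _)) (ln (Gamma _)) h1 h2 => p q h1 h2.
by move=> ? ?; apply/andP; split; lra.
Qed.

End GammaFunction.

(** * Logarithmic sums over separated points *)

Section LogSums.
Variable R : realType.
Implicit Types (x : nat -> R) (A h eta : R).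

(** Only the terms with [k < A] contribute, and their sum is the logarithm of
   [A ^ n / n!], a term of the exponential series of [A]. *)
Lemma sum_ln_le A n : 0 < A ->
  \sum_(k < n) ln (Num.max 1 (A / k.+1%:R)) <= A.
Proof.
move=> A0.
suff [] : (n%:R <= A -> \sum_(k < n) ln (Num.max 1 (A / k.+1%:R)) = ln (A ^+ n / n`!%:R))
  /\ \sum_(k < n) ln (Num.max 1 (A / k.+1%:R)) <= A by [].
elim: n => [|n [IH1 IH2]].
  by rewrite !big_ord0; split; [rewrite expr0 fact0 divr1 ln1|exact: ltW].
rewrite !big_ord_recr/=.
have [nA|nA] := leP n.+1%:R A; last first.
  split => //.
  rewrite max_l ?ln1 ?addr0//.
  by rewrite ler_pdivrMr ?ltr0n// mul1r ltW.
have e : \sum_(k < n) ln (Num.max 1 (A / k.+1%:R)) + ln (Num.max 1 (A / n.+1%:R)) =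
    ln (A ^+ n.+1 / n.+1`!%:R).
  rewrite IH1; last by rewrite (le_trans _ nA)// ler_nat.
  rewrite max_r; last by rewrite ler_pdivlMr ?ltr0n// mul1r.
  rewrite -lnM ?posrE ?divr_gt0 ?exprn_gt0 ?ltr0n ?fact_gt0//.
  rewrite exprSr factS mulnC natrM; congr ln.
  by rewrite mulf_div.
split => //; rewrite e -[leRHS]expRK ler_ln ?posrE ?expR_gt0//; last first.
  by rewrite divr_gt0 ?exprn_gt0 ?ltr0n ?fact_gt0.
by apply: le_trans (expR_ge1Dxn n (ltW A0)); rewrite lerDr.
Qed.

(** Each difference [k] occurs for at most [N] pairs. *)
Lemma sum_pairs_le N (f : nat -> R) : (forall k, 0 <= f k) ->
  \sum_(i < N) \sum_(j < N | (i < j)%N) f (j - i)%N <= N%:R * \sum_(k < N) f k.+1.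
Proof.
move=> f0; rewrite mulr_natl -[X in _ *+ X](card_ord N) -sumr_const.
apply: ler_sum => i _.
rewrite -(big_mkord (fun j => (i < j)%N) (fun j => f (j - i)%N)).
rewrite -(big_mkord xpredT (fun j => f j.+1)).
have iN := ltn_ord i.
rewrite (big_cat_nat _ (n := i.+1))//=.
rewrite big_nat_cond big_pred0 ?add0r; last first.
  by move=> j; rewrite ltnS; case: ltnP; rewrite ?andbF.
rewrite big_nat_cond (eq_bigl (fun j => (i.+1 <= j < N)%N)); last first.
  by move=> j; case: (ltnP i j); rewrite ?andbF ?andbT.
rewrite -big_nat -{1}[i.+1]add0n big_addn.
rewrite (eq_bigr (fun j => f j.+1)); last first.
  by move=> j _; rewrite -addSnnS addnK.
rewrite [leRHS](big_cat_nat _ (n := N - i.+1))//=; last exact: leq_subr.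
by rewrite lerDl sumr_ge0.
Qed.

Definition lnmax eta (s t : R) : R := ln (Num.max `|s - t| eta).

Lemma lnmaxC eta s t : lnmax eta s t = lnmax eta t s.
Proof. by rewrite /lnmax distrC. Qed.

Lemma sum_sym N (K : R -> R -> R) x : (forall s t, K s t = K t s) ->
  \sum_(i < N) \sum_(j < N) K (x i) (x j) =
  2 * (\sum_(i < N) \sum_(j < N | (i < j)%N) K (x i) (x j)) +
  \sum_(i < N) K (x i) (x i).
Proof.
move=> KC.
have e (i : 'I_N) : \sum_(j < N) K (x i) (x j) =
   \sum_(j < N | (i < j)%N) K (x i) (x j) + \sum_(j < N | (j < i)%N) K (x i) (x j)
   + K (x i) (x i).
  rewrite (bigID (fun j : 'I_N => (i < j)%N))/= -addrA; congr (_ + _).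
  rewrite (bigD1 i) ?ltnn//= addrC; congr (_ + _).
  apply: eq_bigl => j; rewrite -leqNgt ltn_neqAle andbC.
  by congr (_ && _).
rewrite (eq_bigr _ (fun i _ => e i)) !big_split/=; congr (_ + _).
rewrite mulr_natl mulr2n; congr (_ + _).
rewrite (exchange_big_dep xpredT)//=; apply: eq_bigr => i _.
by apply: eq_bigr => j _; rewrite KC.
Qed.

(** Truncating the logarithm at level [eta] only affects pairs at distance
   below [eta], and for points at mutual distances at least [h (j - i)] the
   total correction is controlled by [sum_ln_le] with [A = eta / h]. The term
   [N ln eta] is the diagonal of the double sum. *)
Lemma sum_ln_dist N x h eta : 0 < h -> 0 < eta ->
  (forall i j, (i < j)%N -> (j < N)%N -> h * (j - i)%:R <= x i - x j) ->
  \sum_(i < N) \sum_(j < N) lnmax eta (x i) (x j) - N%:R * ln eta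
    - 2 * (N%:R * (eta / h)) <=
  2 * (\sum_(i < N) \sum_(j < N | (i < j)%N) ln (x i - x j)) <=
  \sum_(i < N) \sum_(j < N) lnmax eta (x i) (x j) - N%:R * ln eta.
Proof.
move=> h0 eta0 hx; set S := \sum_(i < N) \sum_(j < N | _) ln _.
set DD := \sum_(i < N) \sum_(j < N) lnmax _ _ _.
have DDE : DD - N%:R * ln eta =
    2 * (\sum_(i < N) \sum_(j < N | (i < j)%N) lnmax eta (x i) (x j)).
  rewrite /DD (sum_sym N _ (lnmaxC eta)) -addrA -[RHS]addr0; congr (_ + _).
  rewrite (eq_bigr (fun=> ln eta)); last first.
    by move=> i _; rewrite /lnmax subrr normr0 max_r// ltW.
  by rewrite sumr_const card_ord mulr_natl subrr.
rewrite DDE -mulrBr !ler_pM2l//.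
have key (i j : 'I_N) : (i < j)%N ->
    ln (x i - x j) <= lnmax eta (x i) (x j) <=
    ln (x i - x j) + ln (Num.max 1 ((eta / h) / (j - i)%:R)).
  move=> ij; have hij := hx _ _ ij (ltn_ord j).
  have k0 : 0 < (j - i)%:R :> R by rewrite ltr0n subn_gt0.
  have hk : 0 < h * (j - i)%:R by rewrite mulr_gt0.
  have d0 : 0 < x i - x j by exact: lt_le_trans hij.
  rewrite /lnmax (gtr0_norm d0); apply/andP; split.
    by rewrite ler_ln ?posrE ?lt_max ?d0// le_max lexx.
  rewrite -lnM ?posrE ?lt_max ?ltr01// ler_ln ?posrE ?lt_max ?d0//; last first.
    by rewrite mulr_gt0// lt_max ltr01.
  rewrite ge_max; apply/andP; split.
    by rewrite ler_peMr ?(ltW d0)// le_max lexx.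
  apply: (@le_trans _ _ ((x i - x j) * (eta / h / (j - i)%:R))); last first.
    by rewrite ler_pM2l// le_max lexx orbT.
  have -> : eta / h / (j - i)%:R = eta / (h * (j - i)%:R).
    by rewrite invfM mulrA.
  by rewrite mulrCA ler_peMr ?(ltW eta0)// ler_pdivlMr// mul1r.
apply/andP; split; last first.
  by apply: ler_sum => i _; apply: ler_sum => j /key/andP[].
rewrite lerBlDr.
apply: (@le_trans _ _ (S + \sum_(i < N) \sum_(j < N | (i < j)%N)
    ln (Num.max 1 ((eta / h) / (j - i)%:R)))).
  rewrite /S -big_split/=; apply: ler_sum => i _.
  by rewrite -big_split/=; apply: ler_sum => j /key/andP[].
rewrite lerD2l.
apply: (le_trans (@sum_pairs_le N (fun k => ln (Num.max 1 (eta / h / k%:R))) _)).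
  by move=> k; rewrite ln_ge0// le_max lexx.
by rewrite ler_wpM2l// sum_ln_le// divr_gt0.
Qed.

Lemma lnmax_lip eta s s' t : 0 < eta ->
  `|lnmax eta s t - lnmax eta s' t| <= eta^-1 * `|s - s'|.
Proof.
move=> eta0.
have aux u v : 0 <= u -> 0 <= v ->
    ln (Num.max u eta) - ln (Num.max v eta) <= eta^-1 * `|u - v|.
  move=> u0 v0; set a := Num.max u eta; set c := Num.max v eta.
  have a0 : 0 < a by rewrite lt_max eta0 orbT.
  have c0 : 0 < c by rewrite lt_max eta0 orbT.
  have ec : eta <= c by rewrite le_max lexx orbT.
  have : ln (a / c) <= a / c - 1.
    by have := @le_ln1Dx R (a / c - 1); rewrite subrKC; apply; rewrite ltrBrDl subrr divr_gt0.
  rewrite ln_div ?posrE// => /le_trans; apply.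
  have -> : a / c - 1 = c^-1 * (a - c) by field; rewrite gt_eqF.
  have ac : a - c <= `|u - v|.
    rewrite /a /c; have := ler_norm (u - v); have := normr_ge0 (u - v).
    by rewrite /Num.max/=; do 2 case: ifPn; rewrite -?leNgt => ? ? ? ?; lra.
  have [ac0|ac0] := leP (a - c) 0.
    apply: (@le_trans _ _ 0); first by rewrite pmulr_rle0 ?invr_gt0.
    by rewrite mulr_ge0// invr_ge0 ltW.
  by apply: ler_pM => //; rewrite ?invr_ge0 ?lef_pV2// ltW.
have tri : `| `|s - t| - `|s' - t| | <= `|s - s'|.
  by apply: le_trans (ler_dist_dist _ _) _; rewrite opprB addrA subrK.
rewrite /lnmax ler_norml; apply/andP; split.
  rewrite lerNl opprB; apply: le_trans (aux _ _ _ _) _ => //.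
  by rewrite ler_pM2l ?invr_gt0// distrC.
apply: le_trans (aux _ _ _ _) _ => //.
by rewrite ler_pM2l ?invr_gt0.
Qed.

End LogSums.

(** * Means and their convergence through distribution functions *)

Section Means.
Variable R : realType.
Implicit Types (b c : R) (L : (R -> R) -> R) (g : R -> R).

(** Boundedness is asked for on [[0, b]] only, so that all continuous functions
   qualify, while measurability on the whole line avoids restrictions. *)
Definition locbm b g :=
  measurable_fun [set: R] g /\ exists c, forall x, 0 <= x <= b -> `|g x| <= c.

(** Integration against a probability concentrated on [[0, b]], seen as a
   functional: this covers empirical measures and densities alike. *)
Definition is_mean b L := [/\
  forall g1 g2, locbm b g1 -> locbm b g2 -> L (fun x => g1 x + g2 x) = L g1 + L g2,
  forall c g, locbm b g -> L (fun x => c * g x) = c * L g,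
  forall g1 g2, locbm b g1 -> locbm b g2 ->
    (forall x, 0 <= x <= b -> g1 x <= g2 x) -> L g1 <= L g2 &
  L (fun=> 1) = 1].

Definition mean_cdf L (t : R) := L (fun x => (x <= t)%R%:R).

Lemma locbm_cst b c : locbm b (fun=> c).
Proof. by split; [exact: measurable_cst|exists `|c|]. Qed.

Lemma locbmD b g1 g2 : locbm b g1 -> locbm b g2 -> locbm b (fun x => g1 x + g2 x).
Proof.
move=> [m1 [c1 h1]] [m2 [c2 h2]]; split; first exact: measurable_funD.
exists (c1 + c2) => x bx; apply: le_trans (ler_normD _ _) _.
by rewrite lerD ?h1 ?h2.
Qed.

Lemma locbmM b g1 g2 : locbm b g1 -> locbm b g2 -> locbm b (fun x => g1 x * g2 x).
Proof.
move=> [m1 [c1 h1]] [m2 [c2 h2]]; split; first exact: measurable_funM.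
by exists (c1 * c2) => x bx; rewrite normrM ler_pM ?h1 ?h2.
Qed.

Lemma locbmZ b c g : locbm b g -> locbm b (fun x => c * g x).
Proof. by apply: locbmM; exact: locbm_cst. Qed.

Lemma locbm_ind b t : locbm b (fun x => (x <= t)%R%:R).
Proof.
split; last by exists 1 => x _; case: (x <= t)%R; rewrite ?normr0 ?normr1.
rewrite (_ : (fun _ => _) = \1_`]-oo, t]); first exact: measurable_indic.
by apply/funext => x; rewrite indicE mem_setE in_itv.
Qed.

Lemma locbm_sum b n (F : nat -> R -> R) : (forall i, locbm b (F i)) ->
  locbm b (fun x => \sum_(i < n) F i x).
Proof.
move=> h; elim: n => [|n IH].
  by under eq_fun do rewrite big_ord0; exact: locbm_cst.
by under eq_fun do rewrite big_ord_recr; exact: locbmD.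
Qed.

Lemma locbm_continuous b g : continuous g -> locbm b g.
Proof.
move=> cg; split; first exact: continuous_measurable_fun.
have [M [_ hM]] : bounded_set (g @` `[0, b]).
  apply: compact_bounded; apply: continuous_compact; last exact: segment_compact.
  exact: continuous_subspaceT.
exists (M + 1) => x xb; apply: (hM (M + 1)); first by rewrite ltrDl.
by exists x => //=; rewrite in_itv.
Qed.

Lemma lip_continuous g c : (forall x y, `|g x - g y| <= c * `|x - y|) -> continuous g.
Proof.
move=> h x; apply/cvgrPdist_le => e e0.
have c0 : 0 < `|c| + 1 by rewrite ltr_wpDl.
near=> y; apply: le_trans (h _ _) _.
apply: (@le_trans _ _ ((`|c| + 1) * `|x - y|)).
  by rewrite ler_wpM2r// (le_trans (ler_norm _))// lerDl.
rewrite -ler_pdivlMl//.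
by near: y; apply: cvgr_dist_le => //; rewrite mulr_gt0 ?invr_gt0.
Unshelve. all: by end_near. Qed.

Section OneMean.
Variables (b : R) (L : (R -> R) -> R).
Hypothesis Lm : is_mean b L.

Lemma mean_cst c : L (fun=> c) = c.
Proof.
have [_ hZ _ h1] := Lm.
rewrite -[RHS]mulr1 -h1 -hZ; last exact: locbm_cst.
by congr L; apply/funext => x; rewrite mulr1.
Qed.

Lemma mean_sum n (F : nat -> R -> R) : (forall i, locbm b (F i)) ->
  L (fun x => \sum_(i < n) F i x) = \sum_(i < n) L (F i).
Proof.
move=> h; have [hD _ _ _] := Lm; elim: n => [|n IH].
  rewrite big_ord0 -[RHS](mean_cst 0); congr L.
  by apply/funext => x; rewrite big_ord0.
rewrite big_ord_recr/= -IH -hD//; last exact: locbm_sum.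
by congr L; apply/funext => x; rewrite big_ord_recr.
Qed.

Lemma mean_dist g1 g2 (e : R) : locbm b g1 -> locbm b g2 ->
  (forall x, 0 <= x <= b -> `|g1 x - g2 x| <= e) -> `|L g1 - L g2| <= e.
Proof.
have [hD hZ hle h1] := Lm.
have aux f1 f2 : locbm b f1 -> locbm b f2 ->
    (forall x, 0 <= x <= b -> `|f1 x - f2 x| <= e) -> L f1 - L f2 <= e.
  move=> bf1 bf2 h; rewrite lerBlDr -(mean_cst e) -hD//; last exact: locbm_cst.
  apply: hle => //; first by apply: locbmD => //; exact: locbm_cst.
  by move=> x /h; rewrite ler_norml => /andP[_]; rewrite lerBlDr.
move=> b1 b2 h; rewrite ler_norml; apply/andP; split; last exact: aux.
by rewrite lerNl opprB; apply: aux => // x /h; rewrite distrC.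
Qed.

End OneMean.

(** The indicator of the [l]-th cell of the subdivision of [[0, b]] into [n]
   intervals [(t_(l-1), t_l]]; the cell of index 0 is [(-oo, 0]]. *)
Definition cell (b : R) (n l : nat) (x : R) : R :=
  (x <= b * l%:R / n%:R)%R%:R - (if l is l'.+1 then (x <= b * l'%:R / n%:R)%R%:R else 0).

Lemma locbm_cell b n l : locbm b (cell b n l).
Proof.
rewrite /cell; under eq_fun => x do rewrite -mulN1r.
apply: locbmD; first exact: locbm_ind.
apply: locbmZ; case: l => [|l]; first exact: locbm_cst.
exact: locbm_ind.
Qed.

Lemma sum_cell b n m x : \sum_(l < m.+1) cell b n l x = (x <= b * m%:R / n%:R)%R%:R.
Proof.
elim: m => [|m IH]; first by rewrite big_ord1 /cell subr0.
by rewrite big_ord_recr/= IH /cell addrC subrK.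
Qed.

Section Grid.
Variables (b : R) (n : nat).
Hypotheses (b0 : 0 < b) (n0 : (0 < n)%N).

Let nR : 0 < n%:R :> R. Proof. by rewrite ltr0n. Qed.

Lemma cell_ge0 l x : 0 <= cell b n l x.
Proof.
rewrite /cell; case: l => [|l]; first by rewrite subr0 ler0n.
rewrite subr_ge0 ler_nat; case: (leP x (b * l%:R / n%:R)) => // h.
suff -> : x <= b * l.+1%:R / n%:R by [].
by rewrite (le_trans h)// ler_pM2r ?invr_gt0// ler_pM2l// ler_nat.
Qed.

Lemma cell_mem l x : 0 <= x -> cell b n l x != 0 -> `|x - b * l%:R / n%:R| <= b / n%:R.
Proof.
rewrite /cell; case: l => [|l] x0.
  rewrite subr0 mulr0 mul0r subr0; case: (leP x 0); last by rewrite eqxx.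
  move=> x0' _.
  have -> : x = 0 by apply/eqP; rewrite eq_le x0 x0'.
  by rewrite normr0 divr_ge0// ltW.
case: (leP x (b * l.+1%:R / n%:R)) => h1; case: (leP x (b * l%:R / n%:R)) => h2;
  rewrite ?subrr ?subr0 ?eqxx//; last first.
  move=> _; exfalso; move: (lt_le_trans h1 h2).
  by rewrite ltr_pM2r ?invr_gt0// ltr_pM2l// ltr_nat ltnNge leqnSn.
move=> _; rewrite distrC ger0_norm ?subr_ge0//.
rewrite lerBlDl -lerBlDr; apply: le_trans (ltW h2).
rewrite -mulrBl -[X in _ * _ - X]mulr1 -mulrBr.
by rewrite -[l.+1]addn1 natrD addrK.
Qed.

(** The cells form a partition of unity on [[0, b]], so [g] is within its
   oscillation over one cell of the step function taking its values at the
   right endpoints. *)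
Lemma grid_approx g (e : R) x :
  (forall u v, 0 <= u <= b -> 0 <= v <= b -> `|u - v| <= b / n%:R -> `|g u - g v| <= e) ->
  0 <= x <= b ->
  `|g x - \sum_(l < n.+1) g (b * l%:R / n%:R) * cell b n l x| <= e.
Proof.
move=> hg xb.
have one : \sum_(l < n.+1) cell b n l x = 1.
  by rewrite sum_cell mulfK ?gt_eqF//; case/andP: xb => _ ->.
have -> : g x = \sum_(l < n.+1) g x * cell b n l x.
  by rewrite -mulr_sumr one mulr1.
rewrite -sumrB; apply: le_trans (ler_norm_sum _ _ _) _.
apply: (@le_trans _ _ (\sum_(l < n.+1) e * cell b n l x)); last first.
  by rewrite -mulr_sumr one mulr1.
apply: ler_sum => l _; rewrite -mulrBl normrM (ger0_norm (cell_ge0 _ _)).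
have [->|hl] := eqVneq (cell b n l x) 0; first by rewrite !mulr0.
apply: ler_wpM2r; first exact: cell_ge0.
apply: hg => //; last by apply: cell_mem => //; case/andP: xb.
apply/andP; split; first by rewrite divr_ge0 ?mulr_ge0 ?ler0n// ltW.
by rewrite ler_pdivrMr// ler_pM2l// ler_nat -ltnS.
Qed.

Lemma mean_grid L g (e : R) : is_mean b L -> locbm b g ->
  (forall u v, 0 <= u <= b -> 0 <= v <= b -> `|u - v| <= b / n%:R -> `|g u - g v| <= e) ->
  `|L g - \sum_(l < n.+1) g (b * l%:R / n%:R) * L (cell b n l)| <= e.
Proof.
move=> Lm bg hg; have [_ hZ _ _] := Lm.
have bF l : locbm b (fun x => g (b * l%:R / n%:R) * cell b n l x).
  by apply: locbmZ; exact: locbm_cell.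
rewrite (eq_bigr (fun l : 'I_n.+1 => L (fun x => g (b * l%:R / n%:R) * cell b n l x)));
  last by move=> l _; rewrite hZ//; exact: locbm_cell.
rewrite -(mean_sum Lm n.+1 bF).
apply: (mean_dist Lm) => //; first exact: (locbm_sum n.+1 bF).
by move=> x xb; exact: grid_approx.
Qed.

End Grid.

(** Continuous functions on a segment are uniformly continuous, in the form
   needed by [mean_grid]. *)
Lemma grid_osc b g (e : R) : 0 < b -> continuous g -> 0 < e ->
  exists2 n, (0 < n)%N & forall u v, 0 <= u <= b -> 0 <= v <= b ->
     `|u - v| <= b / n%:R -> `|g u - g v| <= e.
Proof.
move=> b0 cg e0; apply: contrapT => hn.
have {}hn n : exists uv : R * R, [/\ 0 <= uv.1 <= b, 0 <= uv.2 <= b,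
    `|uv.1 - uv.2| <= b / n.+1%:R & e < `|g uv.1 - g uv.2|].
  apply: contrapT => h; apply: hn; exists n.+1 => // u v hu hv huv.
  by rewrite leNgt; apply/negP => he; apply: h; exists (u, v).
have {hn} [w hw] := choice hn.
have := @segment_compact R 0 b.
move=> /(_ ((fun n => (w n).1) @ \oo))/=.
case.
  by near=> n; have [h _ _ _] := hw n; rewrite /= in_itv.
move=> x [xb hx].
have : nbhs x [set y | `|g x - g y| < e / 4].
  by have /cvgrPdist_lt := cg x; apply; rewrite divr_gt0.
move=> /nbhs_ballP[d /= d0 hd].
have hd' y : `|x - y| < d -> `|g x - g y| < e / 4 by move=> h; apply: hd.
have h1 : \forall n \near \oo, b / n.+1%:R < d / 2.
  near=> n; rewrite ltr_pdivrMr// -ltr_pdivrMl ?divr_gt0//.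
  apply: (@lt_le_trans _ _ n%:R); last by rewrite ler_nat.
  by near: n; exact: nbhs_infty_gtr.
have h2 : nbhs x (ball x (d / 2)) by apply: nbhsx_ballx; rewrite divr_gt0.
have h3 : ((fun n => (w n).1) @ \oo) [set (w n).1 | n in [set n | b / n.+1%:R < d / 2]].
  by apply: filterS h1 => n hn; exists n.
have [_ [[n /= hn <-]] ] := hx _ _ h3 h2.
rewrite /ball/= => xu; have [_ _ uv] := hw n.
have xv : `|x - (w n).2| < d.
  rewrite (le_lt_trans (ler_distD (w n).1 _ _))// [ltRHS]splitr.
  by rewrite ltrD// (le_lt_trans uv).
have xu' : `|x - (w n).1| < d by rewrite (lt_trans xu)// ltr_pdivrMr// ltr_pMr// ltr1n.
apply/negP; rewrite -leNgt.
have := hd' _ xu'; have := hd' _ xv => gv gu.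
apply: le_trans (ler_distD (g x) _ _) _; rewrite (distrC (g (w n).1)).
apply: (@le_trans _ _ (e / 4 + e / 4)); first by rewrite lerD ?ltW.
lra.
Unshelve. all: by end_near. Qed.

Lemma mean_cell b L n l : is_mean b L -> L (cell b n l) =
  mean_cdf L (b * l%:R / n%:R) - (if l is l'.+1 then mean_cdf L (b * l'%:R / n%:R) else 0).
Proof.
move=> Lm; have [hD hZ _ _] := Lm; case: l => [|l].
  rewrite subr0 /mean_cdf; congr L; apply/funext => x.
  by rewrite /cell subr0.
rewrite -mulN1r -hZ; last exact: locbm_ind.
rewrite -hD; last by apply: locbmZ; exact: locbm_ind.
  by congr L; apply/funext => x; rewrite /cell mulN1r.
exact: locbm_ind.
Qed.

Section WeakConvergence.
Variables (T : Type) (F : set_system T).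
Context {FF : Filter F}.
Variables (b : R) (L_ : T -> (R -> R) -> R) (L : (R -> R) -> R).
Hypotheses (b0 : 0 < b) (Lm_ : \forall k \near F, is_mean b (L_ k)) (Lm : is_mean b L).
Hypothesis cdf_cvg : forall t, mean_cdf (L_ k) t @[k --> F] --> mean_cdf L t.

Lemma cvg_approx (a_ : T -> R) (a : R) :
  (forall e, 0 < e -> exists (c_ : T -> R) (c : R),
    [/\ \forall k \near F, `|a_ k - c_ k| <= e, `|a - c| <= e & c_ k @[k --> F] --> c]) ->
  a_ k @[k --> F] --> a.
Proof.
move=> h; apply/cvgrPdist_le => e e0.
have e3 : 0 < e / 3 by rewrite divr_gt0.
have [c_ [c [h1 h2 h3]]] := h _ e3.
have h4 : \forall k \near F, `|c - c_ k| <= e / 3 by move/cvgrPdist_le : h3; apply.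
near=> k.
have h5 : `|a_ k - c_ k| <= e / 3 by near: k.
have h6 : `|c - c_ k| <= e / 3 by near: k.
have -> : a - a_ k = (a - c) + (c - c_ k) - (a_ k - c_ k) by ring.
apply: le_trans (ler_normB _ _) _; apply: le_trans (lerD (ler_normD _ _) (lexx _)) _.
lra.
Unshelve. all: by end_near. Qed.

Lemma cvgr_sum_ord n (f : 'I_n -> T -> R) (a : 'I_n -> R) :
  (forall i : 'I_n, true -> f i k @[k --> F] --> a i) ->
  \sum_(i < n) f i k @[k --> F] --> \sum_(i < n) a i.
Proof. by move=> h; apply: cvg_big => //; exact: add_continuous. Qed.

Let cell_cvg n l : L_ k (cell b n l) @[k --> F] --> L (cell b n l).
Proof.
rewrite (mean_cell n l Lm).
apply: (@cvg_trans _ ((fun k => mean_cdf (L_ k) (b * l%:R / n%:R) -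
   (if l is l'.+1 then mean_cdf (L_ k) (b * l'%:R / n%:R) else 0)) @ F)).
  apply: near_eq_cvg; apply: filterS Lm_ => k Lk.
  by rewrite (mean_cell n l Lk).
apply: cvgB; first exact: cdf_cvg.
by case: l => [|l]; [exact: cvg_cst|exact: cdf_cvg].
Qed.

(** On step functions a mean is a finite combination of values of its
   distribution function; continuous functions are uniform limits of those. *)
Lemma mean_cvg g : continuous g -> L_ k g @[k --> F] --> L g.
Proof.
move=> cg; have bg := locbm_continuous b cg.
apply: cvg_approx => e e0.
have [n n0 hn] := grid_osc b0 cg e0.
exists (fun k => \sum_(l < n.+1) g (b * l%:R / n%:R) * L_ k (cell b n l)).
exists (\sum_(l < n.+1) g (b * l%:R / n%:R) * L (cell b n l)); split.
- by apply: filterS Lm_ => k Lk; exact: mean_grid.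
- exact: mean_grid.
- by apply: cvgr_sum_ord => l _; apply: cvgMr; exact: cell_cvg.
Qed.

(** The inner means [s |-> L_ k (K s)] are Lipschitz with a constant that does
   not depend on [k], so one subdivision approximates all the outer means. *)
Lemma mean2_cvg (K : R -> R -> R) c : 0 < c ->
  (forall s s' t, `|K s t - K s' t| <= c * `|s - s'|) ->
  (forall s t t', `|K s t - K s t'| <= c * `|t - t'|) ->
  L_ k (fun s => L_ k (K s)) @[k --> F] --> L (fun s => L (K s)).
Proof.
move=> c0 K1 K2.
have bK s : locbm b (K s).
  by apply: locbm_continuous; apply: lip_continuous => t t'; exact: K2.
have inner (M : (R -> R) -> R) s s' : is_mean b M ->
    `|M (K s) - M (K s')| <= c * `|s - s'|.
  by move=> Mm; apply: (mean_dist Mm).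
have bI (M : (R -> R) -> R) : is_mean b M -> locbm b (fun s => M (K s)).
  move=> Mm; apply: locbm_continuous; apply: lip_continuous => s s'; exact: inner.
apply: cvg_approx => e e0.
pose n := (Num.truncn (c * b / e)).+1.
have hn : c * (b / n%:R) <= e.
  rewrite mulrA ler_pdivrMr ?ltr0n// -ler_pdivrMl// mulrC.
  by apply: ltW; rewrite truncnS_gt.
have osc (M : (R -> R) -> R) : is_mean b M -> forall u v, 0 <= u <= b -> 0 <= v <= b ->
    `|u - v| <= b / n%:R -> `|M (K u) - M (K v)| <= e.
  move=> Mm u v _ _ uv; apply: le_trans (inner _ _ _ Mm) _; apply: le_trans hn.
  by rewrite ler_pM2l.
exists (fun k => \sum_(l < n.+1) L_ k (K (b * l%:R / n%:R)) * L_ k (cell b n l)).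
exists (\sum_(l < n.+1) L (K (b * l%:R / n%:R)) * L (cell b n l)); split.
- apply: filterS Lm_ => k Lk.
  by apply: (mean_grid b0 _ Lk (bI _ Lk)) => //; exact: osc.
- by apply: (mean_grid b0 _ Lm (bI _ Lm)) => //; exact: osc.
- apply: cvgr_sum_ord => l _; apply: cvgM; last exact: cell_cvg.
  by apply: mean_cvg; apply: lip_continuous => t t'; exact: K2.
Qed.

End WeakConvergence.
End Means.

(** * Bounded densities and their logarithmic energy *)

Section Densities.
Variable R : realType.
Local Notation mu := (@lebesgue_measure R).
Implicit Types (s c eta : R) (chi g : R -> R).

(** The bounds are asked for everywhere, not only almost everywhere, and the
   density vanishes outside [[0, s]], so that integrands can be compared
   pointwise and without restriction of the domain. *)
Definition is_density c s chi := [/\ measurable_fun [set: R] chi,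
  forall x, 0 <= chi x <= c, forall x, x \notin `[0, s] -> chi x = 0 &
  \int[mu]_(x in `[0, s]) chi x = 1].

Definition dmean s chi g : R := \int[mu]_(x in `[0, s]) (g x * chi x).

(** Dyadic majorant of the error made by truncating the logarithm at level
   [eta]; unlike that error, it is trivial to integrate. *)
Lemma lnmax_dyadic eta u : 0 < eta -> 0 <= u ->
  ((`|ln u - ln (Num.max u eta)|)%:E <=
   \sum_(0 <= n <oo) (((u <= eta / 2 ^+ n)%R)%:R)%:E)%E.
Proof.
move=> eta0 u0.
suff [m mu_ hm] : exists2 m : nat, `|ln u - ln (Num.max u eta)| <= m%:R &
    forall n, (n < m)%N -> u <= eta / 2 ^+ n.
  apply: le_trans (@nneseries_lim_ge _ _ xpredT 0 m _); last first.
    by move=> n _ _; rewrite lee_fin ler0n.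
  rewrite sumEFin lee_fin (le_trans mu_)//.
  rewrite big_nat (eq_bigr (fun=> 1)); last by move=> n /andP[_ /hm ->].
  by rewrite -big_nat sumr_const_nat subn0.
have [ue|ue] := leP eta u.
  by exists 0%N; rewrite // subrr normr0.
have [->|u_neq0] := eqVneq u 0.
  exists (Num.truncn `|ln (0 : R) - ln eta|).+1.
    by rewrite ltW// truncnS_gt.
  by move=> n _; rewrite divr_ge0 ?exprn_ge0// ltW.
have {}u0 : 0 < u by rewrite lt_neqAle eq_sym u_neq0.
exists (Num.truncn (ln (eta / u))).+1.
  rewrite -normrN opprB -ln_div ?posrE// ger0_norm ?ltW ?truncnS_gt//.
  by rewrite ln_gt0// ltr_pdivlMr// mul1r.
move=> n; rewrite ltnS => hn.
rewrite ler_pdivlMr ?exprn_gt0// mulrC -ler_pdivlMr//.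
have eu : 0 < eta / u by rewrite divr_gt0.
rewrite -[leRHS]lnK ?posrE//.
apply: (@le_trans _ _ (expR n%:R)).
  rewrite -[n%:R]mulr1 expRM_natl lerXn2r ?nnegrE ?expR_ge0//.
  by apply: le_trans (expR_ge1Dx 1); rewrite -[2]/(1 + 1 : R).
rewrite ler_expR.
apply: (@le_trans _ _ (Num.truncn (ln (eta / u)))%:R); first by rewrite ler_nat.
rewrite truncn_le// ln_ge0// ler_pdivlMr// mul1r ltW//.
Qed.

Definition band s (r : R) : set (R * R) :=
  [set z | z.1 \in `[0, s] /\ (`|z.1 - z.2| <= r)%R].

Lemma measurable_band s r : measurable (band s r : set (measurableTypeR R * measurableTypeR R)).
Proof.
rewrite /band (_ : [set _ | _] = (fst @^-1` `[0, s]) `&`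
   ((fun z => `|z.1 - z.2|) @^-1` `]-oo, r])); last first.
  by apply/seteqP; split => z /= [h1 h2]; split => //=; move: h2; rewrite in_itv.
apply: measurableI.
  by rewrite -[X in measurable X]setTI; apply: measurable_fst => //; exact: measurable_itv.
rewrite -[X in measurable X]setTI.
have h : measurable_fun [set: measurableTypeR R * measurableTypeR R] (fun z => `|z.1 - z.2|).
  by apply: measurableT_comp => //; apply: measurable_funB.
apply: h => //.
Qed.

Lemma band_measure s r : 0 <= s -> 0 <= r ->
  ((mu \x mu)%E (band s r) = (s * (2 * r))%:E)%E.
Proof.
move=> s0 r0; rewrite /product_measure1/=.
rewrite (_ : (fun x => _) = fun x => ((2 * r)%:E * (\1_`[0, s] x)%:E)%E); last first.
  apply/funext => x /=; rewrite indicE mem_setE.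
  have [xs|xs] := boolP (x \in `[0, s]); last first.
    rewrite mule0 (_ : xsection _ _ = set0) ?measure0//.
    by apply/seteqP; split => y //=; rewrite /xsection/= inE => -[/=]; rewrite (negbTE xs).
  rewrite mule1 (_ : xsection _ _ = `[x - r, x + r]%classic).
    rewrite lebesgue_measure_itv/= lte_fin.
    case: ltP => h; first by rewrite -EFinB; congr EFin; ring.
    by congr EFin; lra.
  apply/seteqP; split => y; rewrite /xsection/= inE /band/= ?in_itv/=.
    by move=> [_]; rewrite distrC ler_distl.
  by move=> h; split => //; rewrite distrC ler_distl.
rewrite ge0_integralZl//=; last 2 first.
- by apply/measurable_EFinP; exact: measurable_indic.
- by rewrite lee_fin mulr_ge0.
rewrite integral_indic// setIT [X in (_ * X)%E](_ : _ = s%:E).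
  by rewrite -EFinM mulrC.
transitivity (mu `[0, s]%classic) => //.
rewrite lebesgue_measure_itv/= lte_fin; case: ltP => h; first by rewrite oppr0 adde0.
by congr EFin; apply/eqP; rewrite eq_le h s0.
Qed.

Lemma measurable_lnmax eta :
  measurable_fun [set: measurableTypeR R * measurableTypeR R] (fun z => lnmax eta z.1 z.2).
Proof.
apply: measurableT_comp; first exact: measurable_ln.
apply: measurable_maxr => //.
by apply: measurableT_comp => //; apply: measurable_funB.
Qed.

Lemma measurable_lndist :
  measurable_fun [set: measurableTypeR R * measurableTypeR R] (fun z => ln `|z.1 - z.2|).
Proof.
apply: measurableT_comp; first exact: measurable_ln.
by apply: measurableT_comp => //; apply: measurable_funB.
Qed.


Section OneDensity.
Variables (c s : R) (chi : R -> R).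
Hypotheses (s0 : 0 <= s) (dchi : is_density c s chi).

Let mchi : measurable_fun [set: R] chi. Proof. by case: dchi. Qed.
Let chi0 x : 0 <= chi x. Proof. by case: dchi => _ /(_ x)/andP[]. Qed.
Let chic x : chi x <= c. Proof. by case: dchi => _ /(_ x)/andP[]. Qed.
Let c0 : 0 <= c. Proof. exact: le_trans (chi0 0) (chic 0). Qed.

Let seg_lty : (mu `[0%R, s]%classic < +oo)%E.
Proof. by rewrite lebesgue_measure_itv/=; case: ifP => _; rewrite ?ltry. Qed.

Lemma dmean_integrable b g : s <= b -> locbm b g ->
  mu.-integrable `[0, s] (EFin \o (fun x => g x * chi x)).
Proof.
move=> sb [mg [k hk]]; apply: measurable_bounded_integrable => //.
  by apply: measurable_funTS; exact: measurable_funM.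
exists (k * c); split; first exact: num_real.
move=> M kM x; rewrite /= in_itv/= => /andP[x0 xs].
apply: le_trans (ltW kM); rewrite normrM ler_pM//.
  by apply: hk; rewrite x0 (le_trans xs).
by rewrite ger0_norm.
Qed.

Lemma dmean_mean b : s <= b -> is_mean b (dmean s chi).
Proof.
move=> sb; rewrite /dmean; split.
- move=> g1 g2 b1 b2; under eq_Rintegral do rewrite mulrDl.
  by rewrite RintegralD//; exact: (dmean_integrable sb).
- move=> k g bg; under eq_Rintegral do rewrite -mulrA.
  by rewrite RintegralZl//; exact: (dmean_integrable sb).
- move=> g1 g2 b1 b2 h; apply: le_Rintegral => //; try exact: (dmean_integrable sb).
  move=> x; rewrite /= in_itv/= => /andP[x0 xs]; apply: ler_wpM2r => //.
  by apply: h; rewrite x0 (le_trans xs).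
- under eq_Rintegral do rewrite mul1r.
  by case: dchi.
Qed.

Let D : set (measurableTypeR R * measurableTypeR R) := `[0, s] `*` `[0, s].

Let mD : measurable D.
Proof. by apply: measurableX; exact: measurable_itv. Qed.

Let D_lty : ((mu \x mu) D < +oo)%E.
Proof.
rewrite product_measure1E//; try exact: measurable_itv.
by rewrite lte_mul_pinfty// ge0_fin_numE.
Qed.

Let m1 : measurable_fun [set: measurableTypeR R * measurableTypeR R] (fun z => chi z.1).
Proof. exact: (measurableT_comp mchi). Qed.
Let m2 : measurable_fun [set: measurableTypeR R * measurableTypeR R] (fun z => chi z.2).
Proof. exact: (measurableT_comp mchi). Qed.

Lemma lnmax_bounded eta : 0 < eta -> exists k, forall x y, 0 <= x <= s -> 0 <= y <= s ->
  `|lnmax eta x y| <= k.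
Proof.
move=> eta0; exists (`|ln eta| + `|ln (s + eta)|) => x y /andP[x0 xs] /andP[y0 ys].
have h1 : ln eta <= lnmax eta x y.
  by rewrite ler_ln ?posrE ?lt_max ?eta0 ?orbT// le_max lexx orbT.
have h2 : lnmax eta x y <= ln (s + eta).
  rewrite ler_ln ?posrE ?lt_max ?eta0 ?orbT//; last by rewrite ltr_wpDl.
  rewrite ge_max; apply/andP; split; last by rewrite lerDr.
  rewrite ler_norml; apply/andP; split; lra.
rewrite ler_norml; apply/andP; split.
  rewrite lerNl; have := ler_norm (- ln eta); rewrite normrN.
  have := normr_ge0 (ln (s + eta)); lra.
have := ler_norm (ln (s + eta)); have := normr_ge0 (ln eta); lra.
Qed.

Let Gtr eta (z : R * R) : R := lnmax eta z.1 z.2 * chi z.1 * chi z.2.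
Let G (z : R * R) : R := ln `|z.1 - z.2| * chi z.1 * chi z.2.

Let Gtr_integrable eta : 0 < eta -> (mu \x mu)%E.-integrable D (EFin \o Gtr eta).
Proof.
move=> eta0; apply: measurable_bounded_integrable => //.
  apply: measurable_funTS; apply: measurable_funM => //.
  by apply: measurable_funM => //; exact: measurable_lnmax.
have [k hk] := lnmax_bounded eta0.
exists (k * c * c); split; first exact: num_real.
move=> M kM [x y] [/=]; rewrite !in_itv/= => hx hy.
apply: le_trans (ltW kM); rewrite /Gtr/= !normrM.
by rewrite ler_pM ?mulr_ge0// ?ler_pM// ?hk// ger0_norm.
Qed.

Let dyad eta (z : R * R) : \bar R :=
  (\sum_(0 <= n <oo) ((\1_(band s (eta / 2 ^+ n)) z)%:E : \bar R))%E.

Let dyad_integral eta : 0 < eta ->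
  (\int[(mu \x mu)%E]_(z in D) dyad eta z <= (s * (4 * eta))%:E)%E.
Proof.
move=> eta0; rewrite /dyad integral_nneseries//; last first.
  by move=> n; apply/measurable_EFinP/measurable_indic; exact: measurable_band.
apply: (@le_trans _ _ (\sum_(0 <= n <oo) (s * (4 * eta) / (2 ^ n.+1)%:R)%:E)%E); last first.
  by apply: epsilon_trick0; rewrite !mulr_ge0// ltW.
apply: lee_nneseries => [n _ _|n _].
  by apply: integral_ge0 => z _; rewrite lee_fin.
have e0 : 0 <= eta / 2 ^+ n by rewrite divr_ge0 ?exprn_ge0// ltW.
rewrite integral_indic//; last exact: measurable_band.
apply: (@le_trans _ _ ((mu \x mu)%E (band s (eta / 2 ^+ n)))).
  rewrite le_measure ?inE//; [|exact: measurable_band].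
  by apply: measurableI => //; exact: measurable_band.
rewrite band_measure// lee_fin natrX exprS le_eqVlt; apply/orP; left; apply/eqP.
by field; rewrite expf_neq0.
Qed.

Let G_dist eta z : 0 < eta -> D z ->
  (`|(G z - Gtr eta z)%:E| <= (c * c)%:E * dyad eta z)%E.
Proof.
move=> eta0 [/= h1 h2].
have -> : G z - Gtr eta z = (ln `|z.1 - z.2| - lnmax eta z.1 z.2) * (chi z.1 * chi z.2).
  by rewrite /G /Gtr; ring.
rewrite /= normrM [X in _ * X]ger0_norm ?mulr_ge0// mulrC EFinM.
apply: lee_pmul; rewrite ?lee_fin ?mulr_ge0//; first by rewrite ler_pM.
apply: le_trans (lnmax_dyadic eta0 (normr_ge0 _)) _.
rewrite le_eqVlt; apply/orP; left; apply/eqP; apply: eq_eseriesr => n _.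
rewrite indicE /band; congr ((nat_of_bool _)%:R)%:E.
by apply/idP/idP => [h|]; rewrite inE/=; [split|case].
Qed.

Let dyad_measurable eta : measurable_fun D (dyad eta).
Proof.
apply: ge0_emeasurable_sum => //.
by move=> n _; apply/measurable_EFinP/measurable_indic; exact: measurable_band.
Qed.

Let GB_integral eta : 0 < eta ->
  (\int[(mu \x mu)%E]_(z in D) `|(G z - Gtr eta z)%:E| <= (c * c * (s * (4 * eta)))%:E)%E.
Proof.
move=> eta0.
have mG : measurable_fun D G.
  apply: measurable_funTS; apply: measurable_funM => //.
  by apply: measurable_funM => //; exact: measurable_lndist.
have mGt : measurable_fun D (Gtr eta) by have /measurable_int/measurable_EFinP := Gtr_integrable eta0.
apply: (@le_trans _ _ (\int[(mu \x mu)%E]_(z in D) ((c * c)%:E * dyad eta z))%E).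
  apply: ge0_le_integral => //.
  - by apply: measurableT_comp => //; apply/measurable_EFinP; exact: measurable_funB.
  - by apply: measurable_funeM; exact: dyad_measurable.
  - by move=> z Dz; exact: G_dist.
rewrite ge0_integralZl//.
- by rewrite [leRHS]EFinM; apply: lee_wpmul2l; [rewrite lee_fin mulr_ge0|exact: dyad_integral].
- by move=> z _; apply: nneseries_ge0 => n _ _; rewrite lee_fin.
- by rewrite lee_fin mulr_ge0.
Qed.

Let GB_integrable eta : 0 < eta ->
  (mu \x mu)%E.-integrable D (EFin \o (fun z => G z - Gtr eta z)).
Proof.
move=> eta0; apply/integrableP; split.
  apply/measurable_EFinP; apply: measurable_funB.
    apply: measurable_funTS; apply: measurable_funM => //.
    by apply: measurable_funM => //; exact: measurable_lndist.
  by have /measurable_int/measurable_EFinP := Gtr_integrable eta0.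
by apply: le_lt_trans (GB_integral eta0) _; rewrite ltry.
Qed.

Lemma G_lnmax eta : 0 < eta ->
  `|\int[(mu \x mu)%E]_(z in D) G z - \int[(mu \x mu)%E]_(z in D) Gtr eta z|
    <= c * c * (s * (4 * eta)).
Proof.
move=> eta0.
have iG : (mu \x mu)%E.-integrable D (EFin \o G).
  have := integrableD mD (GB_integrable eta0) (Gtr_integrable eta0).
  apply: eq_integrable => // z _; rewrite /= -EFinD; congr EFin.
  by rewrite subrK.
rewrite -RintegralB//; last exact: Gtr_integrable.
rewrite -lee_fin EFin_normr_Rintegral//; last exact: GB_integrable.
apply: le_trans (le_abse_integral _ mD _) (GB_integral eta0).
by have := GB_integrable eta0; apply: measurable_int.
Qed.

Lemma Gtr_fubini eta : 0 < eta ->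
  \int[(mu \x mu)%E]_(z in D) Gtr eta z =
  dmean s chi (fun x => dmean s chi (lnmax eta x)).
Proof.
move=> eta0; have chi_out x : x \notin `[0, s] -> chi x = 0 by case: dchi => _ _ /(_ x).
have iT : (mu \x mu)%E.-integrable setT (EFin \o Gtr eta).
  have := Gtr_integrable eta0; rewrite integrable_mkcond//.
  apply: eq_integrable => // z _; rewrite /patch; case: ifPn => //.
  move=> zD; rewrite /Gtr/=.
  have [z1|/chi_out ->] := boolP (z.1 \in `[0, s]); last by rewrite mulr0 mul0r.
  have [z2|/chi_out ->] := boolP (z.2 \in `[0, s]); last by rewrite mulr0.
  by case/negP: zD; rewrite inE.
rewrite /Rintegral integral_mkcond.
rewrite (_ : (fun z => _) \_ D = EFin \o Gtr eta); last first.
  apply/funext => z; rewrite /patch; case: ifPn => // zD; rewrite /Gtr/=.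
  have [z1|/chi_out ->] := boolP (z.1 \in `[0, s]); last by rewrite mulr0 mul0r.
  have [z2|/chi_out ->] := boolP (z.2 \in `[0, s]); last by rewrite mulr0.
  by case/negP: zD; rewrite inE.
rewrite -(integral12_prod_meas1 iT) /dmean /Rintegral; congr fine.
rewrite [RHS]integral_mkcond; apply: eq_integral => x _.
rewrite /fubini_F/= /patch; case: ifPn => xs; last first.
  rewrite /Gtr/= chi_out; last by move: xs; rewrite mem_setE.
  by under eq_integral do rewrite mulr0 mul0r; rewrite integral0.
rewrite EFinM fineK; last first.
  apply: integrable_fin_num => //; apply: (@dmean_integrable s) => //.
  by apply: locbm_continuous; apply: lip_continuous => t t'; rewrite !(lnmaxC eta x); exact: lnmax_lip.
rewrite muleC -integralZl//; last first.
  apply: (@dmean_integrable s) => //.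
  by apply: locbm_continuous; apply: lip_continuous => t t'; rewrite !(lnmaxC eta x); exact: lnmax_lip.
rewrite [RHS]integral_mkcond; apply: eq_integral => y _.
rewrite /patch; case: ifPn => ys; last first.
  by rewrite /Gtr/= (chi_out y) ?mulr0//; move: ys; rewrite mem_setE.
by rewrite /Gtr/= -EFinM; congr EFin; ring.
Qed.

End OneDensity.

(** The logarithm and its truncation differ only on the strip
   [|x - y| < eta], where the difference, although unbounded, is dominated by
   the sum of the indicators of the dyadic strips [|x - y| <= eta / 2 ^ n]; the
   areas of these strips sum up to at most [4 eta s]. *)
Lemma energy_lnmax theta V c s chi eta : 0 < theta -> 0 <= s -> 0 < eta ->
  is_density c s chi ->
  `|energy theta V s chi -
     (dmean s chi V - theta * dmean s chi (fun x => dmean s chi (lnmax eta x)))|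
    <= theta * (c * c * (s * (4 * eta))).
Proof.
move=> th0 s0 eta0 d; rewrite /energy.
have := G_lnmax s0 d eta0; rewrite (Gtr_fubini s0 d eta0) => h.
set A := \int[_]_(z in _) _ in h *; set B := dmean s chi (fun=> _) in h *.
rewrite -/(dmean s chi V).
have -> : - theta * A + dmean s chi V - (dmean s chi V - theta * B) = - (theta * (A - B)) by ring.
by rewrite normrN normrM gtr0_norm// ler_pM2l.
Qed.

Lemma density_admissible theta s chi : 0 <= s -> is_density theta^-1 s chi ->
  admissible theta s chi.
Proof.
move=> s0 d; have [mchi chi0 chis chi1] := d; split => //.
  have := dmean_integrable d (lexx s) (locbm_cst s 1).
  by apply: eq_integrable => // x _; rewrite /= mul1r.
by apply: aeW => x _; exact: chi0.
Qed.

Section Truncation.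
Variables (theta s : R) (psi : R -> R).
Hypotheses (th0 : 0 < theta) (adm : admissible theta s psi).

(** Redefining an admissible function on a null set makes its bounds hold
   everywhere. *)
Definition trunc_density (x : R) : R :=
  if x \in `[0, s] then Num.min (Num.max (psi x) 0) theta^-1 else 0.
Let chi := trunc_density.

Let mpsi : measurable_fun `[0, s] psi.
Proof. by case: adm => /measurable_int/measurable_EFinP. Qed.

Let mchi : measurable_fun [set: R] chi.
Proof.
rewrite (_ : chi = (fun x => Num.min (Num.max (psi x) 0) theta^-1) \_ `[0, s]); last first.
  by apply/funext => x; rewrite /patch mem_setE.
apply/measurable_restrict => //; rewrite setTI.
by apply: measurable_minr => //; exact: measurable_maxr.
Qed.

Lemma trunc_density_ae : exists N, [/\ measurable N, mu N = 0%E &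
  forall x, x \in `[0, s] -> ~ N x -> psi x = chi x].
Proof.
have [_ [N [mN N0 sub]] _] := adm.
exists N; split => // x xs Nx.
have [/andP[h1 h2]] : 0 <= psi x <= theta^-1.
  by apply: contrapT => h; apply: Nx; apply: sub => /= /(_ xs).
by rewrite /chi /trunc_density xs max_l// min_l.
Qed.

Lemma trunc_density_int g : measurable_fun `[0, s] g ->
  \int[mu]_(x in `[0, s]) (g x * psi x) = \int[mu]_(x in `[0, s]) (g x * chi x).
Proof.
move=> mg; congr fine; apply: ae_eq_integral => //.
- by apply/measurable_EFinP; exact: measurable_funM.
- apply/measurable_EFinP; apply: measurable_funM => //.
  exact: measurable_funTS.
have [N [mN N0 hN]] := trunc_density_ae.
exists N; split => // x /= h; apply: contrapT => Nx; apply: h => xs.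
by rewrite hN.
Qed.

Lemma trunc_density_density : is_density theta^-1 s chi.
Proof.
split => //.
- move=> x; rewrite /chi /trunc_density; case: ifPn => _; last by rewrite lexx invr_ge0 ltW.
  by rewrite le_min ge_min lexx orbT andbT le_max lexx orbT invr_ge0 ltW.
- by move=> x; rewrite /chi /trunc_density => /negbTE ->.
- have [_ _ <-] := adm.
  have := @trunc_density_int (fun=> 1) (measurable_cst _).
  by under eq_Rintegral do rewrite mul1r; under [in RHS]eq_Rintegral do rewrite mul1r.
Qed.

Lemma trunc_density_energy V : measurable_fun `[0, s] V ->
  energy theta V s psi = energy theta V s chi.
Proof.
move=> mV; rewrite /energy; congr (_ * _ + _); last exact: trunc_density_int.
have mD : measurable (`[0, s] `*` `[0, s] : set (measurableTypeR R * measurableTypeR R)).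
  by apply: measurableX; exact: measurable_itv.
congr fine; apply: ae_eq_integral => //.
- apply/measurable_EFinP; apply: measurable_funM.
    apply: measurable_funM; first by apply: measurable_funTS; exact: measurable_lndist.
    apply: (measurable_comp (F := `[0, s])) => //.
      by move=> _ [z [h1 h2] <-].
    exact: measurable_funTS.
  apply: (measurable_comp (F := `[0, s])) => //.
    by move=> _ [z [h1 h2] <-].
  exact: measurable_funTS.
- apply/measurable_EFinP; apply: measurable_funTS; apply: measurable_funM.
    apply: measurable_funM; first exact: measurable_lndist.
    exact: (measurableT_comp mchi).
  exact: (measurableT_comp mchi).
have [N [mN N0 hN]] := trunc_density_ae.
exists ((N `*` setT) `|` (setT `*` N)); split => /=.
- by apply: measurableU; apply: measurableX.
- rewrite measureU0; try exact: measurableX.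
    by transitivity (mu N * mu setT)%E; [exact: product_measure1E|rewrite N0 mul0e].
  by transitivity (mu setT * mu N)%E; [exact: product_measure1E|rewrite N0 mule0].
- move=> [x y] /= h; apply: contrapT => Nxy; apply: h => -[/= xs ys].
  rewrite !hN//= => Nh; apply: Nxy; [right|left]; split => //.
Qed.

End Truncation.

End Densities.

(** * Limits of distribution functions along ultrafilters *)

Section LipschitzDensity.
Variable R : realType.
Local Notation mu := (@lebesgue_measure R).

Lemma ls_measure_itv (f : cumulative R R) (a b : R) : a <= b ->
  lebesgue_stieltjes_measure f `]a, b]%classic = (f b - f a)%:E.
Proof.
move=> ab; rewrite /lebesgue_stieltjes_measure /measure_extension.
by rewrite measurable_mu_extE/=; [rewrite wlength_itv_bnd|exact: is_ocitv].
Qed.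

Variables (c : R) (F : R -> R).
Hypotheses (c0 : 0 < c) (Flip : forall a b, a <= b -> 0 <= F b - F a <= c * (b - a)).

Let Fnd : {homo F : x y / x <= y}.
Proof. by move=> x y /Flip/andP[]; rewrite subr_ge0. Qed.

Let Fcont : continuous F.
Proof.
apply: (@lip_continuous _ _ c) => x y.
have [xy|/ltW yx] := leP x y.
  have /andP[h1 h2] := Flip xy.
  by rewrite distrC ger0_norm// distrC ger0_norm// subr_ge0.
have /andP[h1 h2] := Flip yx.
by rewrite !ger0_norm// subr_ge0.
Qed.

Let Gnd : {homo (fun x => c * x - F x) : x y / x <= y}.
Proof. by move=> x y /Flip/andP[_]; lra. Qed.

Let Gcont : continuous (fun x => c * x - F x).
Proof.
move=> x; apply: cvgB; last exact: Fcont.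
by apply: cvgMr; exact: cvg_id.
Qed.

Let Fc : cumulative R R := HB.pack F
  (@isCumulative.Build R _ R F Fnd (right_continuousW Fcont)).

Let Gc : cumulative R R := HB.pack (fun x => c * x - F x)
  (@isCumulative.Build R _ R (fun x => c * x - F x) Gnd (right_continuousW Gcont)).

Let c_inv_gt0 : 0 < c^-1. Proof. by rewrite invr_gt0. Qed.

(** [F] and [c * x - F x] are both distribution functions, whose measures add
   up to [c] times the Lebesgue measure. *)
Lemma ls_le_lebesgue (A : set (measurableTypeR R)) : measurable A ->
  (lebesgue_stieltjes_measure Fc A <= c%:E * mu A)%E.
Proof.
move=> mA.
pose m : {measure set (measurableTypeR R) -> \bar R} :=
  mscale (NngNum (ltW c_inv_gt0))
    (measure_add (lebesgue_stieltjes_measure Fc) (lebesgue_stieltjes_measure Gc)).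
have mE X : m X = ((c^-1)%:E * (lebesgue_stieltjes_measure Fc X +
    lebesgue_stieltjes_measure Gc X))%E.
  by congr (_ * _)%E; exact: measure_addE.
have -> : mu A = m A.
  apply: lebesgue_measure_unique => // X /ocitvP[->|[[a b] /= ab ->]].
    by rewrite !measure0.
  rewrite mE !ls_measure_itv ?ltW//= /lebesgue_measure ls_measure_itv ?ltW//=.
  rewrite -EFinD -EFinM; congr EFin.
  by field; rewrite gt_eqF.
rewrite mE muleA -EFinM divff ?gt_eqF// mul1e.
by rewrite leeDl.
Qed.

Variable s : R.
Hypotheses (s0 : 0 <= s) (F0 : forall t, t <= 0 -> F t = 0) (F1 : forall t, s <= t -> F t = 1).

Let FNy : F @ -oo --> (0 : R).
Proof.
apply: cvg_near_cst.
by near=> x; apply: F0; near: x; exact: nbhs_ninfty_le.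
Unshelve. all: by end_near. Qed.

Let Fy : F @ +oo --> (1 : R).
Proof.
apply: cvg_near_cst.
by near=> x; apply: F1; near: x; apply: nbhs_pinfty_ge; exact: num_real.
Unshelve. all: by end_near. Qed.

Let Fb : cumulativeBounded (0 : R) (1 : R) := HB.pack F
  (@isCumulative.Build R _ R F Fnd (right_continuousW Fcont))
  (@isCumulativeBounded.Build R 0 1 F FNy Fy).

Let nu : probability (measurableTypeR R) R := lebesgue_stieltjes_measure Fb.

Let nu_le A : measurable A -> (nu A <= c%:E * mu A)%E.
Proof. exact: ls_le_lebesgue. Qed.

Let nu_itv a b : a <= b -> nu `]a, b]%classic = (F b - F a)%:E.
Proof. exact: ls_measure_itv. Qed.

Let nu_null (x : R) : nu [set x] = 0%E.
Proof.
apply/eqP; rewrite -measure_le0; apply: le_trans (nu_le _) _ => //.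
by rewrite lebesgue_measure_set1 mule0.
Qed.

Let nu_cc (t : R) : 0 <= t -> nu `[0, t]%classic = (F t)%:E.
Proof.
move=> t0; rewrite -(@setU1itv _ _ (BRight t) 0 false) ?bnd_simp// setUC.
rewrite measureU0//; last exact: nu_null.
by apply: etrans (nu_itv t0) _; rewrite (F0 (lexx 0)) subr0.
Qed.

(** The Lebesgue-Stieltjes measure of [F] is at most [c] times the Lebesgue
   measure, so it has a Radon-Nikodym density, which is at most [c] almost
   everywhere and is then truncated to satisfy this bound everywhere. *)
Lemma lipschitz_density : exists2 chi, is_density c s chi &
  forall t, mean_cdf (dmean s chi) t = F t.
Proof.
have dom : nu `<< mu.
  apply/null_content_dominatesP => A mA A0; apply/eqP; rewrite -measure_le0.
  by apply: le_trans (nu_le mA) _; rewrite A0 mule0.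
have [f [f0 ffin fint fE]] := radon_nikodym_sigma_finite dom.
pose p x := fine (f x).
have pE x : f x = (p x)%:E by rewrite /p fineK.
have p0 x : 0 <= p x by rewrite fine_ge0.
have mf : measurable_fun setT f := measurable_int _ fint.
have mp : measurable_fun [set: measurableTypeR R] p.
  by apply/measurable_EFinP; apply: eq_measurable_fun mf => x _; rewrite /= pE.
have ip A : measurable A -> mu.-integrable A (EFin \o p).
  move=> mA; apply: (@integrableS _ _ _ _ setT) => //.
  by apply: eq_integrable fint => // x _; rewrite /= pE.
have nuE A : measurable A -> nu A = (\int[mu]_(x in A) (p x)%:E)%E.
  by move=> mA; rewrite fE//; apply: eq_integral => x _; rewrite pE.
pose E : set (measurableTypeR R) := `[0, s] `&` (p @^-1` `]c, +oo[).
have mE : measurable E.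
  apply: measurableI; first exact: measurable_itv.
  by rewrite -[X in measurable X]setTI; apply: mp => //; exact: measurable_itv.
have Elty : (mu E < +oo)%E.
  apply: (@le_lt_trans _ _ (mu `[0, s]%classic)).
    by apply: le_measure; rewrite ?inE//; exact: subIsetl.
  by rewrite lebesgue_measure_itv/=; case: ifP => _; rewrite ?ltry.
have ic : mu.-integrable E (EFin \o cst c).
  apply: measurable_bounded_integrable => //; exists `|c|; split; first exact: num_real.
  by move=> M cM x _; exact: ltW.
have E0 : (\int[mu]_(x in E) `|(p x - c)%:E| = 0)%E.
  rewrite (eq_integral (fun x => (p x)%:E - c%:E)%E); last first.
    move=> x; rewrite inE => -[_]; rewrite /= in_itv/= andbT => cp.
    by rewrite ger0_norm ?subr_ge0 ?ltW.
  have icE : (\int[mu]_(x in E) ((p x)%:E - c%:E) = nu E - c%:E * mu E)%E.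
    rewrite (integralB_EFin mE (ip _ mE) ic) -nuE//; congr (_ - _)%E.
    exact: (@integral_cst _ _ _ mu _ mE c%:E).
  rewrite icE; apply/eqP; rewrite eq_le; apply/andP; split.
    by rewrite leeBlDr ?add0e ?nu_le// fin_numM// ge0_fin_numE.
  rewrite -icE; apply: integral_ge0 => x [_]; rewrite /= in_itv/= andbT => cp.
  by rewrite -EFinB lee_fin subr_ge0 ltW.
have aeE : ae_eq mu E (fun x => (p x - c)%:E) (cst 0%E).
  apply/ae_eq_integral_abs => //.
  apply/measurable_EFinP; apply: measurable_funB => //.
  exact: measurable_funTS.
have nu1 : (\int[mu]_(x in `[0%R, s]) (p x)%:E = 1)%E.
  by rewrite -nuE ?nu_cc ?F1//; exact: measurable_itv.
have adm : admissible c^-1 s p.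
  split.
  - by apply: ip; exact: measurable_itv.
  - have [N [mN N0 hN]] := aeE; exists N; split => // x /= h.
    apply: hN => /= h2; apply: h => xs; rewrite p0 invrK leNgt; apply/negP => cp.
    have : (p x - c)%:E = 0%E.
      by apply: h2; split => //=; rewrite in_itv/= cp.
    by move=> [] /eqP; rewrite subr_eq0 gt_eqF.
  - by rewrite /Rintegral nu1.
have cV0 : 0 < c^-1 by rewrite invr_gt0.
exists (trunc_density c^-1 s p).
  by have := trunc_density_density cV0 adm; rewrite invrK.
move=> t; rewrite /mean_cdf /dmean -(trunc_density_int adm); last first.
  by apply: measurable_funTS; have [] := locbm_ind s t.
transitivity (fine (\int[mu]_(x in `[0%R, s]) ((EFin \o p) \_ `]-oo, t]) x)%E).
  congr fine; apply: eq_integral => x _; rewrite /patch mem_setE in_itv/=.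
  by case: (x <= t); rewrite ?mul1r ?mul0r.
rewrite -integral_mkcondr -nuE; last by apply: measurableI; exact: measurable_itv.
have [t0|t0] := ltP t 0.
  rewrite (_ : _ `&` _ = set0) ?measure0 ?F0 ?ltW//.
  apply/seteqP; split => x //=; rewrite !in_itv/= => -[/andP[x0 _] xt].
  by have := lt_le_trans t0 (le_trans x0 xt); rewrite ltxx.
have [ts|/ltW st] := leP t s.
  rewrite (_ : _ `&` _ = `[0, t]%classic) ?nu_cc//.
  apply/seteqP; split => x /=; rewrite !in_itv/=; first by move=> [/andP[-> _] ->].
  by move=> /andP[-> xt]; rewrite xt (le_trans xt).
rewrite (_ : _ `&` _ = `[0, s]%classic) ?nu_cc// ?F1//.
apply/seteqP; split => x /=; rewrite !in_itv/=; first by case.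
by move=> /andP[-> xs]; rewrite xs (le_trans xs).
Qed.

End LipschitzDensity.

Section UltraLimit.
Variables (R : realType) (T : Type) (U : set_system T).
Hypothesis UU : UltraFilter U.

(** This is where compactness enters: along an ultrafilter a bounded function
   needs no extraction of a subsequence to converge. *)
Lemma ultra_cvg_itv (f : T -> R) (a b : R) : (\forall k \near U, a <= f k <= b) ->
  exists l : R, f k @[k --> U] --> l.
Proof.
move=> fab; have PU := @ultra_proper _ _ UU.
have := @segment_compact R a b; move=> /(_ (f @ U))/=.
case; first by apply: filterS fab => k; rewrite /= in_itv.
move=> l [_ hl]; exists l => A nA.
have [//|UA] := in_ultra_setVsetC (f @^-1` A) UU.
have h : (f @ U) (~` A) by [].
by have [x []] := hl _ _ h nA.
Qed.

(** The distribution functions [Phi k] may jump by [err k], as those of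
   configurations do; in the limit these jumps disappear. *)
Lemma ultra_density (c s : R) (Phi : T -> R -> R) (err : T -> R) :
  0 < c -> 0 <= s ->
  (forall a b, a <= b -> \forall k \near U, 0 <= Phi k b - Phi k a <= c * (b - a) + err k) ->
  err k @[k --> U] --> (0 : R) ->
  (forall t, t < 0 -> \forall k \near U, Phi k t = 0) ->
  (forall t, s < t -> \forall k \near U, Phi k t = 1) ->
  exists2 chi, is_density c s chi &
    forall t, Phi k t @[k --> U] --> mean_cdf (dmean s chi) t.
Proof.
move=> c0 s0 hPhi herr h0 h1; have PU := @ultra_proper _ _ UU.
have bound t : \forall k \near U, 0 <= Phi k t <= 1.
  have m1 : Num.min t 0 - 1 < 0.
    by rewrite ltrBlDr add0r; apply: le_lt_trans (ltr01); rewrite ge_min lexx orbT.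
  have m2 : s < Num.max t s + 1.
    by apply: le_lt_trans (_ : Num.max t s < _); rewrite ?le_max ?lexx ?orbT// ltrDl.
  have t1 : Num.min t 0 - 1 <= t.
    by rewrite lerBlDr (@le_trans _ _ t)// ?ge_min ?lexx// lerDl.
  have t2 : t <= Num.max t s + 1.
    by rewrite (@le_trans _ _ (Num.max t s)) ?le_max ?lexx// lerDl.
  have H1 := hPhi _ _ t1; have H2 := hPhi _ _ t2; have H3 := h0 _ m1; have H4 := h1 _ m2.
  near=> k.
  have /andP[] : 0 <= Phi k t - Phi k (Num.min t 0 - 1) <= c * (t - (Num.min t 0 - 1)) + err k.
    by near: k.
  have -> : Phi k (Num.min t 0 - 1) = 0 by near: k.
  have /andP[] : 0 <= Phi k (Num.max t s + 1) - Phi k t <= c * (Num.max t s + 1 - t) + err k.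
    by near: k.
  have -> : Phi k (Num.max t s + 1) = 1 by near: k.
  by rewrite subr0 subr_ge0 => -> _ ->.
have [F hF] := choice (fun t => ultra_cvg_itv (bound t)).
have Flip a b : a <= b -> 0 <= F b - F a <= c * (b - a).
  move=> ab; have hd : Phi k b - Phi k a @[k --> U] --> F b - F a by exact: cvgB.
  have he : c * (b - a) + err k @[k --> U] --> c * (b - a) + 0.
    by apply: cvgD => //; exact: cvg_cst.
  rewrite addr0 in he.
  apply/andP; split.
    apply: (cvgr_to_ge hd).
    by apply: filterS (hPhi _ _ ab) => k /andP[].
  rewrite -subr_ge0; apply: (cvgr_to_ge (cvgB he hd)).
  by apply: filterS (hPhi _ _ ab) => k /andP[_]; rewrite -subr_ge0.
have Fneg t : t < 0 -> F t = 0.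
  move=> t0; have : Phi k t @[k --> U] --> (0 : R).
    by apply: cvg_near_cst; exact: h0.
  exact: cvg_unique (hF t).
have Fpos t : s < t -> F t = 1.
  move=> t0; have : Phi k t @[k --> U] --> (1 : R).
    by apply: cvg_near_cst; exact: h1.
  exact: cvg_unique (hF t).
have F0 t : t <= 0 -> F t = 0.
  rewrite le_eqVlt => /predU1P[->|/Fneg//].
  apply/eqP; rewrite eq_le; apply/andP; split.
    apply/ler_addgt0Pr => e e0.
    have ec : 0 < e / c by rewrite divr_gt0.
    have ne : - (e / c) <= 0 by rewrite oppr_le0 ltW.
    have /andP[_] := Flip _ _ ne.
    rewrite (Fneg (- (e / c))) ?oppr_lt0// subr0 opprK add0r mulrCA divff ?gt_eqF// mulr1 add0r.
    by [].
  have n1 : (-1 : R) <= 0 by rewrite oppr_le0.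
  have /andP[] := Flip _ _ n1.
  by rewrite (Fneg (-1)) ?oppr_lt0// subr0.
have F1 t : s <= t -> F t = 1.
  rewrite le_eqVlt => /predU1P[<-|/Fpos//].
  apply/eqP; rewrite eq_le; apply/andP; split.
    have n1 : s <= s + 1 by rewrite lerDl.
    have /andP[] := Flip _ _ n1.
    by rewrite (Fpos (s + 1)) ?ltrDl// subr_ge0.
  apply/ler_addgt0Pr => e e0.
  have ec : 0 < e / c by rewrite divr_gt0.
  have n1 : s <= s + e / c by rewrite lerDl ltW.
  have /andP[_] := Flip _ _ n1.
  rewrite (Fpos (s + e / c)) ?ltrDl// [s + _]addrC addrK mulrCA divff ?gt_eqF// mulr1.
  by rewrite lerBlDl addrC.
have [chi dchi hchi] := lipschitz_density c0 Flip s0 F0 F1.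
by exists chi => // t; rewrite hchi.
Unshelve. all: by end_near. Qed.

End UltraLimit.

(** * Configurations and quantiles *)

Section Counting.
Variable R : realType.

Lemma count_le N (B : R) : 0 <= B -> \sum_(k < N) (k%:R <= B)%R%:R <= B + 1.
Proof.
move=> B0.
suff [] : \sum_(k < N) (k%:R <= B)%R%:R <= N%:R :> R /\
  \sum_(k < N) (k%:R <= B)%R%:R <= B + 1 by [].
elim: N => [|n [IH1 IH2]]; first by rewrite big_ord0; split; lra.
rewrite big_ord_recr/= -natr1; case: (leP n%:R B) => h; last by rewrite addr0; split; lra.
have e : ((true : nat)%:R : R) = 1 by [].
by split; lra.
Qed.

Lemma count_ge N (B : R) : B <= N%:R -> B <= \sum_(k < N) (k%:R < B)%R%:R.
Proof.
elim: N B => [|n IH] B hB; first by rewrite big_ord0.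
rewrite big_ord_recr/=; case: (ltP n%:R B) => h; last by rewrite addr0 IH.
apply: (@le_trans _ _ (n%:R + 1)); first by rewrite natr1.
rewrite lerD2r -[X in X%:R <= _]card_ord -sumr_const; apply: ler_sum => k _.
suff -> : k%:R < B by [].
by apply: lt_trans h; rewrite ltr_nat.
Qed.

Lemma count_diam N (P : pred nat) (B : R) : 0 <= B ->
  (forall i j, (i < j)%N -> (j < N)%N -> P i -> P j -> (j - i)%:R <= B) ->
  \sum_(i < N) (P i)%:R <= B + 1.
Proof.
move=> B0; elim: N => [|n IH] hP; first by rewrite big_ord0; lra.
have [Pn|/negbTE Pn] := boolP (P n); last first.
  rewrite big_ord_recr/= Pn addr0; apply: IH => i j ij jn.
  by apply: hP => //; exact: ltnW.
apply: le_trans (count_le n.+1 B0).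
rewrite (reindex_inj rev_ord_inj)/=; apply: ler_sum => i _.
rewrite subSS; have [Pi|] := boolP (P (n - i)%N); last by rewrite ler0n.
suff -> : i%:R <= B by [].
have [->//|i0] := posnP i.
have := hP (n - i)%N n; rewrite subKn -1?ltnS//; apply => //.
by have := ltn_ord i; lia.
Qed.

End Counting.

Section Configurations.
Variables (R : realType) (theta : R).
Hypothesis th0 : 0 < theta.
Implicit Types (N M : nat).

Definition position N M (lam : N.-tuple 'I_M.+1) (i : nat) : R := ell theta lam i / N%:R.

Definition emp N M (lam : N.-tuple 'I_M.+1) (g : R -> R) : R :=
  N%:R^-1 * \sum_(i < N) g (position lam i).

Lemma ell_gap N M (lam : N.-tuple 'I_M.+1) i j : lam \in W N M ->
  (i < j)%N -> (j < N)%N -> theta * (j - i)%:R <= ell theta lam i - ell theta lam j.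
Proof.
rewrite inE => slam ij jN.
have le_nth : (nth ord0 lam j <= nth ord0 lam i)%N.
  have tr : transitive (fun a b : 'I_M.+1 => (b <= a)%N).
    by move=> a b c /= h1 h2; exact: leq_trans h2 h1.
  have rf : reflexive (fun a b : 'I_M.+1 => (b <= a)%N) by move=> a /=.
  apply: (sorted_leq_nth tr rf) => //; rewrite ?inE ?size_tuple ?(ltn_trans ij)//.
  exact: ltnW.
rewrite /ell.
have -> : (N - i.+1)%:R = (N - j.+1)%:R + (j - i)%:R :> R.
  by rewrite -natrD; congr (_%:R); lia.
have : ((nth ord0 lam j)%:R : R) <= (nth ord0 lam i)%:R by rewrite ler_nat.
lra.
Qed.

Lemma ell_ge0 N M (lam : N.-tuple 'I_M.+1) i : 0 <= ell theta lam i.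
Proof. by rewrite addr_ge0// mulr_ge0// ltW. Qed.

Lemma ell_le N M (lam : N.-tuple 'I_M.+1) i :
  ell theta lam i <= M%:R + (N%:R - 1) * theta \/ N = 0%N.
Proof.
case: N lam => [|N] lam; [by right|left].
rewrite /ell lerD//; first by rewrite ler_nat -ltnS.
apply: ler_wpM2r; first exact: ltW.
by rewrite -natr1 addrK ler_nat subSS leq_subr.
Qed.

Lemma position_ge0 N M (lam : N.-tuple 'I_M.+1) i : 0 <= position lam i.
Proof. by rewrite divr_ge0// ell_ge0. Qed.

Lemma position_le N M (lam : N.-tuple 'I_M.+1) i : (0 < N)%N ->
  position lam i <= M%:R * N%:R^-1 + (N%:R - 1) * N%:R^-1 * theta.
Proof.
move=> N0; have nR : 0 < N%:R :> R by rewrite ltr0n.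
rewrite /position ler_pdivrMr//.
have [h|h] := ell_le lam i; last by rewrite h in N0.
apply: (le_trans h); rewrite le_eqVlt; apply/orP; left; apply/eqP.
by field; rewrite gt_eqF.
Qed.

Lemma emp_mean N M (lam : N.-tuple 'I_M.+1) (b : R) : (0 < N)%N ->
  (forall i, (i < N)%N -> position lam i <= b) -> is_mean b (emp lam).
Proof.
move=> N0 hb; have nR : 0 < N%:R :> R by rewrite ltr0n.
rewrite /emp; split.
- by move=> g1 g2 _ _; rewrite -mulrDr -big_split.
- by move=> c g _; rewrite mulrCA; congr (_ * _); rewrite mulr_sumr.
- move=> g1 g2 _ _ h; rewrite ler_pM2l ?invr_gt0//.
  by apply: ler_sum => i _; apply: h; rewrite position_ge0 hb.
- by rewrite sumr_const card_ord mulVf// gt_eqF.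
Qed.

(** Particles are at least [theta / N] apart, so an interval of length [l]
   contains at most [N l / theta + 1] of them. *)
Lemma emp_cdf_lip N M (lam : N.-tuple 'I_M.+1) (a b : R) : (0 < N)%N -> lam \in W N M ->
  a <= b -> 0 <= mean_cdf (emp lam) b - mean_cdf (emp lam) a <= theta^-1 * (b - a) + N%:R^-1.
Proof.
move=> N0 lamW ab; have nR : 0 < N%:R :> R by rewrite ltr0n.
rewrite /mean_cdf /emp -mulrBr -sumrB.
have e (i : 'I_N) : (position lam i <= b)%R%:R - (position lam i <= a)%R%:R =
    (a < position lam i <= b)%R%:R :> R.
  case: (leP (position lam i) b) => h1; case: (leP (position lam i) a) => h2;
    rewrite ?subrr ?subr0//.
  by move: (lt_le_trans h1 (le_trans h2 ab)); rewrite ltxx.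
rewrite (eq_bigr _ (fun i _ => e i)).
apply/andP; split.
  by rewrite mulr_ge0 ?invr_ge0 ?ler0n// sumr_ge0.
rewrite ler_pdivrMl// mulrDr divff ?gt_eqF//.
have B0 : 0 <= N%:R * (theta^-1 * (b - a)).
  by rewrite mulr_ge0// mulr_ge0 ?invr_ge0 ?subr_ge0// ltW.
apply: (count_diam (P := fun i => a < position lam i <= b)) => // i j ij jN.
move=> /andP[_ ib] /andP[ja _].
have gap := ell_gap lamW ij jN.
have -> : N%:R * (theta^-1 * (b - a)) = (N%:R * (b - a)) / theta by ring.
rewrite ler_pdivlMr// mulrC; apply: (le_trans gap).
have pE k : ell theta lam k = N%:R * position lam k.
  by rewrite /position mulrCA divff ?mulr1// gt_eqF.
rewrite !pE -mulrBr ler_pM2l//; lra.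
Qed.

Section Quantiles.
Variables (s : R) (chi : R -> R).
Hypotheses (s0 : 0 <= s) (dchi : is_density theta^-1 s chi).
Local Notation mu := (@lebesgue_measure R).
Let F := mean_cdf (dmean s chi).
Let Lm : is_mean s (dmean s chi) := dmean_mean dchi (lexx s).

Let Flip a b : a <= b -> 0 <= F b - F a <= theta^-1 * (b - a).
Proof.
move=> ab; have [mchi hchi _ _] := dchi; have [hD hZ hle h1] := Lm.
have bmi := @locbm_ind R s.
apply/andP; split.
  rewrite subr_ge0; apply: hle => // x _; rewrite ler_nat.
  by case: (leP x a) => // xa; rewrite (le_trans xa ab).
have -> : F b - F a = dmean s chi (fun x => \1_`]a, b] x).
  rewrite /F /mean_cdf -mulN1r -hZ// -hD//; last exact: locbmZ.
  congr (dmean _ _); apply/funext => x; rewrite indicE mem_setE in_itv/=.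
  case: (leP x b) => xb; case: (leP x a) => xa; rewrite ?andbF/=; try ring.
  by have := lt_le_trans xb (le_trans xa ab); rewrite ltxx.
have th1 : 0 < theta^-1 by rewrite invr_gt0.
have ii : mu.-integrable `[0, s] (EFin \o (fun x => theta^-1 * \1_`]a, b] x)).
  have := @integrable_indic_itv R a b false false => /(integrableZl measurableT theta^-1) h.
  by apply: integrableS h.
apply: (@le_trans _ _ (\int[mu]_(x in `[0, s]) (theta^-1 * \1_`]a, b] x))).
  apply: le_Rintegral => //.
    apply: (dmean_integrable dchi (lexx s)); split; first exact: measurable_indic.
    by exists 1 => x _; rewrite indicE; case: (_ \in _); rewrite ?normr1 ?normr0.
  move=> x _; rewrite mulrC; apply: ler_wpM2r; first by rewrite indicE ler0n.
  by have /andP[] := hchi x.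
rewrite RintegralZl//; last first.
  by have := @integrable_indic_itv R a b false false; apply: integrableS.
rewrite ler_pM2l// /Rintegral integral_indic//.
rewrite -lee_fin fineK; last first.
  rewrite ge0_fin_numE//; apply: (@le_lt_trans _ _ (mu `[0, s]%classic)).
    by apply: le_measure; rewrite ?inE//; apply: measurableI.
  by rewrite lebesgue_measure_itv/=; case: ifP => _; rewrite ?ltry.
apply: (@le_trans _ _ (mu `]a, b]%classic)).
  by apply: le_measure; rewrite ?inE//; apply: measurableI.
rewrite lebesgue_measure_itv/= lte_fin; case: ltP => h; first by rewrite -EFinB.
by rewrite lee_fin subr_ge0.
Qed.

Let F0 : F 0 = 0.
Proof.
have [_ _ hle _] := Lm.
apply/eqP; rewrite eq_le; apply/andP; split; last first.
  rewrite -[X in X <= _](mean_cst Lm 0).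
  by apply: hle; [exact: locbm_cst|exact: locbm_ind|move=> x _; rewrite ler0n].
apply/ler_addgt0Pr => e e0.
have ne : - (theta * e) <= 0 by rewrite oppr_le0 mulr_ge0// ltW.
have /andP[_] := Flip ne.
have -> : F (- (theta * e)) = 0.
  apply/eqP; rewrite eq_le; apply/andP; split; rewrite -[X in _ <= X](mean_cst Lm 0) || rewrite -[X in X <= _](mean_cst Lm 0).
    apply: hle; [exact: locbm_ind|exact: locbm_cst|move=> x /andP[x0 _]].
    rewrite leNgt; suff -> : (x <= - (theta * e)) = false by rewrite ltxx.
    by apply/negbTE; rewrite -ltNge (lt_le_trans _ x0)// oppr_lt0 mulr_gt0.
  by apply: hle; [exact: locbm_cst|exact: locbm_ind|move=> x _; rewrite ler0n].
by rewrite subr0 opprK add0r mulKf ?gt_eqF// add0r.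
Qed.

Let Fs : F s = 1.
Proof.
have [_ _ hle <-] := Lm; apply/eqP; rewrite eq_le; apply/andP; split.
  apply: hle; [exact: locbm_ind|exact: locbm_cst|move=> x _].
  by rewrite -[1]/(1%:R) ler_nat leq_b1.
apply: hle; [exact: locbm_cst|exact: locbm_ind|move=> x /andP[_ ->]].
by [].
Qed.

Let F_le1 t : F t <= 1.
Proof.
have [_ _ hle <-] := Lm.
apply: hle; [exact: locbm_ind|exact: locbm_cst|move=> x _].
by rewrite -[1]/(1%:R) ler_nat leq_b1.
Qed.

Let F_ge0 t : 0 <= F t.
Proof.
have [_ _ hle _] := Lm; rewrite -[X in X <= _](mean_cst Lm 0).
by apply: hle; [exact: locbm_cst|exact: locbm_ind|move=> x _; rewrite ler0n].
Qed.

Let Fcont : continuous F.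
Proof.
apply: (@lip_continuous _ _ theta^-1) => x y.
have [xy|/ltW yx] := leP x y.
  have /andP[h1 h2] := Flip xy.
  by rewrite distrC ger0_norm// distrC ger0_norm// subr_ge0.
have /andP[h1 h2] := Flip yx.
by rewrite !ger0_norm// subr_ge0.
Qed.

Let quantile_exists (v : R) : 0 <= v <= 1 -> exists y, 0 <= y <= s /\ F y = v.
Proof.
move=> /andP[v0 v1].
have [|y ys <-] := @IVT R F 0 s v s0 (continuous_subspaceT Fcont).
  by rewrite F0 Fs min_l// max_r// v0.
by exists y; split => //; move: ys; rewrite in_itv.
Qed.

(** Rounding the quantiles of order [j / N] down to the lattice; they are
   spaced by at least [theta / N] because the density is at most
   [theta^-1]. *)
Lemma quantile_configuration N M : (0 < N)%N ->
  exists2 lam : N.-tuple 'I_M.+1, lam \in W N M &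
    forall t, `|mean_cdf (emp lam) t - F t| <=
      theta^-1 * ((1 + theta) / N%:R + `|s - theta - M%:R / N%:R|) + N%:R^-1.
Proof.
move=> N0; have nR : 0 < N%:R :> R by rewrite ltr0n.
have thge0 := ltW th0.
have jN01 j : (j < N)%N -> 0 <= (j%:R / N%:R : R) <= 1.
  move=> jN; rewrite divr_ge0//= ler_pdivrMr// mul1r ler_nat ltnW//.
have [y hy] : exists y : nat -> R, forall j, (j < N)%N -> 0 <= y j <= s /\ F (y j) = j%:R / N%:R.
  suff /choice[y hy] : forall j, exists y, (j < N)%N -> 0 <= y <= s /\ F y = j%:R / N%:R.
    by exists y.
  move=> j.
  by have [/jN01/quantile_exists [y hy]|_] := ltnP j N; [exists y|exists 0].
have ygap i j : (i <= j)%N -> (j < N)%N -> theta * (j - i)%:R <= N%:R * (y j - y i).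
  move=> ij jN; have [yi Fi] := hy _ (leq_ltn_trans ij jN); have [yj Fj] := hy _ jN.
  have dF : F (y j) - F (y i) = (j - i)%:R / N%:R by rewrite Fi Fj -mulrBl natrB.
  have [|/ltW yji] := leP (y i) (y j).
    move=> /Flip/andP[_]; rewrite dF ler_pdivrMr// -mulrA ler_pdivlMl//.
    by rewrite [_ * N%:R]mulrC.
  have /andP[h _] := Flip yji.
  have : (j - i)%:R / N%:R <= 0 :> R by rewrite -dF -opprB oppr_le0.
  rewrite pmulr_lle0 ?invr_gt0// => h2.
  have -> : (j - i)%:R = 0 :> R by apply/eqP; rewrite eq_le h2 ler0n.
  have : (j - i)%:R = 0 :> R by apply/eqP; rewrite eq_le h2 ler0n.
  move/eqP; rewrite pnatr_eq0 subn_eq0 => ji.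
  have -> : i = j by apply/eqP; rewrite eqn_leq ij ji.
  by rewrite mulr0 subrr mulr0.
(* In terms of the increasing order [j], [r j] is the unrounded value of the
   part of the partition; it is nondecreasing because of [ygap]. *)
pose r j := N%:R * y j - j%:R * theta.
have r_homo i j : (i <= j)%N -> (j < N)%N -> r i <= r j.
  move=> ij jN; have := ygap _ _ ij jN; rewrite natrB// /r; lra.
have r_ge0 j : (j < N)%N -> 0 <= r j.
  move=> jN; apply: le_trans (r_homo 0%N j (leq0n _) jN).
  have [/andP[y0 _] _] := hy _ N0.
  by rewrite /r mul0r subr0 mulr_ge0// ltW.
have r_le j : (j < N)%N -> r j <= N%:R * (s - theta) + theta.
  move=> jN; have N1 : (N.-1 < N)%N by rewrite prednK.
  apply: (le_trans (r_homo j N.-1 _ N1)); first by rewrite -ltnS prednK.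
  have [/andP[_ ys] _] := hy _ N1.
  have := ler_wpM2l (ltW nR) ys.
  have e : N%:R = N.-1%:R + 1 :> R by rewrite natr1 prednK.
  have e2 : N%:R * theta = N.-1%:R * theta + theta by rewrite e; ring.
  rewrite /r mulrBr e2; lra.
(* Parts are listed in decreasing order, whence the reversal of indices; the
   minimum with [M] enforces the upper bound on the first part. *)
pose lam : N.-tuple 'I_M.+1 := [tuple inord (minn M (Num.truncn (r (N - i.+1)%N))) | i < N].
have lamE i : (i < N)%N -> nth ord0 lam i = minn M (Num.truncn (r (N - i.+1)%N)) :> nat.
  move=> iN; rewrite -[i]/(nat_of_ord (Ordinal iN)) -tnth_nth tnth_mktuple.
  by rewrite inordK// ltnS geq_minl.
have rev_lt i : (i < N)%N -> (N - i.+1 < N)%N by move=> iN; lia.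
exists lam.
  rewrite inE; apply/(sortedP ord0) => i; rewrite size_tuple => iN.
  rewrite !lamE ?(ltnW iN)// leq_min geq_minl/=.
  apply: leq_trans (geq_minr _ _) _; apply: le_truncn.
  by apply: r_homo; [lia|exact/rev_lt/ltnW].
pose d := (1 + theta) / N%:R + `|s - theta - M%:R / N%:R|.
have pos i : (i < N)%N -> `|position lam i - y (N - i.+1)%N| <= d.
  move=> iN; have jN := rev_lt _ iN; set j := (N - i.+1)%N in jN *.
  have -> : position lam i - y j = ((minn M (Num.truncn (r j)))%:R - r j) / N%:R.
    rewrite /position /ell lamE// -/j /r.
    by field; rewrite gt_eqF.
  have -> : d = (1 + theta + `|N%:R * (s - theta) - M%:R|) / N%:R.
    rewrite /d [RHS]mulrDl; congr (_ + _).
    have -> : N%:R * (s - theta) - M%:R = N%:R * (s - theta - M%:R / N%:R).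
      by field; rewrite gt_eqF.
    by rewrite normrM (gtr0_norm nR) mulrAC divff ?gt_eqF// mul1r.
  rewrite normf_div (gtr0_norm nR) ler_pM2r ?invr_gt0//.
  have /andP[t1 t2] := truncn_itv (r_ge0 _ jN).
  rewrite -natr1 in t2.
  have n0 := normr_ge0 (N%:R * (s - theta) - M%:R).
  have [h|h] := leqP (Num.truncn (r j)) M.
    rewrite ler_norml; apply/andP; split; lra.
  have : (M%:R : R) < (Num.truncn (r j))%:R by rewrite ltr_nat.
  have := r_le _ jN; have := ler_norm (N%:R * (s - theta) - M%:R) => h1 h2 h3.
  rewrite ler_norml; apply/andP; split; lra.
have d0 : 0 <= d by rewrite addr_ge0// divr_ge0// addr_ge0.
move=> t; rewrite -/d; clear lamE; clearbody lam d.
have mE : mean_cdf (emp lam) t = N%:R^-1 * \sum_(j < N) (position lam (N - j.+1)%N <= t)%R%:R.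
  rewrite /mean_cdf /emp; congr (_ * _).
  by rewrite (reindex_inj rev_ord_inj).
have posr j : (j < N)%N -> `|position lam (N - j.+1)%N - y j| <= d.
  move=> jN; have := pos _ (rev_lt _ jN).
  by have -> : (N - (N - j.+1).+1)%N = j by lia.
rewrite ler_norml; apply/andP; split.
- have td : t - d <= t by lra.
  have /andP[_ h1] := Flip td.
  suff h2 : F (t - d) <= mean_cdf (emp lam) t.
    have : 0 <= N%:R^-1 :> R by rewrite invr_ge0.
    lra.
  rewrite mE ler_pdivlMl//.
  have h3 : N%:R * F (t - d) <= N%:R by rewrite ger_pMr.
  apply: (le_trans (count_ge h3)); apply: ler_sum => j _.
  have [jF|_] := boolP (j%:R < N%:R * F (t - d)); last by rewrite ler0n.
  suff -> : position lam (N - j.+1) <= t by [].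
  have [_ Fj] := hy _ (ltn_ord j); have := posr _ (ltn_ord j).
  suff : y j <= t - d by rewrite ler_norml => ? /andP[_]; lra.
  rewrite leNgt; apply/negP => /ltW/Flip/andP[]; rewrite subr_ge0 Fj => h4 _.
  move: jF; rewrite -ltr_pdivrMl// mulrC => /lt_le_trans/(_ h4).
  by rewrite ltxx.
- have td : t <= t + d by lra.
  have /andP[_ h1] := Flip td.
  suff h2 : mean_cdf (emp lam) t <= F (t + d) + N%:R^-1 by lra.
  rewrite mE ler_pdivrMl// mulrDr divff ?gt_eqF//.
  have h3 : 0 <= N%:R * F (t + d) by rewrite mulr_ge0.
  apply: le_trans (count_le N h3); apply: ler_sum => j _.
  have [pt|_] := boolP (position lam (N - j.+1) <= t); last by rewrite ler0n.
  suff -> : j%:R <= N%:R * F (t + d) by [].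
  have [_ Fj] := hy _ (ltn_ord j); have := posr _ (ltn_ord j).
  rewrite ler_norml => /andP[h4 _].
  have yj : y j <= t + d by lra.
  have /andP[] := Flip yj; rewrite subr_ge0 Fj => + _.
  by rewrite ler_pdivrMr// mulrC.
Qed.

End Quantiles.

End Configurations.

(** * Weights and the discrete energy *)

Section DiscreteEnergy.
Variables (R : realType) (theta : R).
Hypothesis th0 : 0 < theta.

Definition cut_energy (eta : R) (V : R -> R) (L : (R -> R) -> R) : R :=
  L V - theta * L (fun x => L (lnmax eta x)).

(** The double sum runs over [i < j] only, which is why the factor is
   [2 theta]; the diagonal is left out. *)
Definition config_energy (V : R -> R) N M (lam : N.-tuple 'I_M.+1) : R :=
  emp theta lam V - 2 * theta / N%:R ^+ 2 *
    \sum_(i < N) \sum_(j < N | (i < j)%N)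
       ln (position theta lam i - position theta lam j).

Lemma position_gap N M (lam : N.-tuple 'I_M.+1) i j : lam \in W N M ->
  (i < j)%N -> (j < N)%N ->
  theta / N%:R * (j - i)%:R <= position theta lam i - position theta lam j.
Proof.
move=> lamW ij jN; have N0 : (0 < N)%N by apply: leq_trans jN.
rewrite /position -mulrBl mulrAC ler_pM2r ?invr_gt0 ?ltr0n//.
exact: ell_gap.
Qed.

(** Here [h = theta / N] in [sum_ln_dist]: each of the [N] particles has at most
   about [eta N / theta] others within distance [eta] on each side, which
   makes an error [O (eta)] after division by [N ^ 2]. *)
Lemma config_energy_cut N M (lam : N.-tuple 'I_M.+1) V eta :
  (0 < N)%N -> lam \in W N M -> 0 < eta ->
  `|config_energy V lam - cut_energy eta V (emp theta lam)| <=
     theta * `|ln eta| / N%:R + 2 * eta.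
Proof.
move=> N0 lamW eta0; have nR : 0 < N%:R :> R by rewrite ltr0n.
have h0 : 0 < theta / N%:R by rewrite divr_gt0.
have /andP[] := sum_ln_dist h0 eta0 (fun i j => @position_gap _ _ lam i j lamW).
rewrite /config_energy /cut_energy.
set S := \sum_(i < N) \sum_(j < N) _.
set P := \sum_(i < N) \sum_(j < N | _) _ => h1 h2.
have -> : emp theta lam (fun x => emp theta lam (lnmax eta x)) = S / N%:R ^+ 2.
  by rewrite /emp -mulr_sumr mulrA mulrC expr2 invfM.
have -> : emp theta lam V - 2 * theta / N%:R ^+ 2 * P - (emp theta lam V - theta * (S / N%:R ^+ 2))
    = (theta * (S - 2 * P)) / N%:R ^+ 2 by ring.
rewrite normf_div [`|_ ^+ 2|]ger0_norm ?sqr_ge0// ler_pdivrMr ?exprn_gt0//.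
have -> : (theta * `|ln eta| / N%:R + 2 * eta) * N%:R ^+ 2 =
   theta * (N%:R * `|ln eta| + 2 * (N%:R * (eta / (theta / N%:R)))).
  by field; rewrite !gt_eqF.
rewrite normrM (gtr0_norm th0) ler_pM2l//.
have l1 : N%:R * ln eta <= N%:R * `|ln eta| by rewrite ler_pM2l// ler_norm.
have l2 : - (N%:R * ln eta) <= N%:R * `|ln eta| by rewrite -mulrN ler_pM2l// -normrN ler_norm.
have l3 : 0 <= N%:R * (eta / (theta / N%:R)) by rewrite mulr_ge0 ?ler0n// divr_ge0// ltW.
by rewrite ler_norml; apply/andP; split; lra.
Qed.

(** The contribution to the logarithm of a weight of the change of scale
   [l_i = N x_i]; it is the same for all configurations. *)
Definition log_scale N : R := \sum_(i < N) \sum_(j < N | (i < j)%N) 2 * theta * ln N%:R.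

(** The errors [C / (l_i - l_j)] of [Q_asymptotics] add up to a harmonic sum,
   as [l_i - l_j] is at least [theta (j - i)]. *)
Lemma weight_energy : exists2 C : R, 0 <= C &
  forall (N M : nat) (lam : N.-tuple 'I_M.+1) (U V : R -> R) (e : R),
  (0 < N)%N -> lam \in W N M ->
  (forall i, (i < N)%N -> `|U (position theta lam i) - V (position theta lam i)| <= e) ->
  0 < weight theta U lam /\
  `|ln (weight theta U lam) - (log_scale N - N%:R ^+ 2 * config_energy V lam)| <=
    N%:R ^+ 2 * (C * (N%:R^-1 * \sum_(k < N) k.+1%:R^-1) + e).
Proof.
have [C C0 hQ] := Q_asymptotics th0; exists (C / theta); first by rewrite divr_ge0// ltW.
move=> N M lam U V e N0 lamW hU; have nR : 0 < N%:R :> R by rewrite ltr0n.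
pose d (i j : nat) := ell theta lam i - ell theta lam j.
have dge (i j : nat) : (i < j)%N -> (j < N)%N -> theta * (j - i)%:R <= d i j.
  by move=> ij jN; exact: ell_gap.
have dth (i j : nat) : (i < j)%N -> (j < N)%N -> theta <= d i j.
  move=> ij jN; apply: le_trans (dge _ _ ij jN).
  by rewrite ler_peMr ?(ltW th0)// ler1n subn_gt0.
have Qgt0 (i j : 'I_N) : (i < j)%N -> 0 < Q theta (d i j).
  by move=> ij; have [] := hQ _ (dth _ _ ij (ltn_ord j)).
have p1 : 0 < \prod_(i < N) \prod_(j < N | (i < j)%N) Q theta (d i j).
  by apply: prodr_gt0 => i _; apply: prodr_gt0 => j ij; exact: Qgt0.
have p2 : 0 < \prod_(i < N) expR (- (N%:R * U (position theta lam i))).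
  by apply: prodr_gt0 => i _; exact: expR_gt0.
have w0 : 0 < weight theta U lam by rewrite /weight mulr_gt0.
split => //.
have lnprod (I : finType) (P : pred I) (F : I -> R) : (forall i, P i -> 0 < F i) ->
    ln (\prod_(i | P i) F i) = \sum_(i | P i) ln (F i).
  move=> F0.
  suff [] : 0 < \prod_(i | P i) F i /\ ln (\prod_(i | P i) F i) = \sum_(i | P i) ln (F i) by [].
  elim/big_ind2 : _ => [|x1 x2 y1 y2 [a1 a2] [b1 b2]|i Pi].
  - by rewrite ln1.
  - by rewrite mulr_gt0// lnM ?posrE// a2 b2.
  - by rewrite F0.
rewrite /weight lnM ?posrE// lnprod; last first.
  by move=> i _; apply: prodr_gt0 => j ij; exact: Qgt0.
rewrite (eq_bigr (fun i : 'I_N => \sum_(j < N | (i < j)%N) ln (Q theta (d i j)))); last first.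
  by move=> i _; rewrite lnprod// => j ij; exact: Qgt0.
rewrite lnprod; last by move=> i _; exact: expR_gt0.
rewrite [X in _ + X - _](eq_bigr (fun i : 'I_N => - (N%:R * U (position theta lam i)))); last first.
  by move=> i _; rewrite expRK.
rewrite sumrN -mulr_sumr.
set S1 := \sum_(i < N) \sum_(j < N | _) _.
pose S2 := \sum_(i < N) \sum_(j < N | (i < j)%N) (2 * theta * ln (d i j)).
have S2E : S2 = log_scale N + 2 * theta * \sum_(i < N) \sum_(j < N | (i < j)%N)
       ln (position theta lam i - position theta lam j).
  rewrite /log_scale mulr_sumr -big_split; apply: eq_bigr => i _ /=.
  rewrite mulr_sumr -big_split; apply: eq_bigr => j ij /=.
  rewrite -mulrDr -lnM ?posrE//; last first.
    apply: lt_le_trans (position_gap lamW ij (ltn_ord j)).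
    by rewrite mulr_gt0 ?divr_gt0// ltr0n subn_gt0.
  by congr (_ * ln _); rewrite /position /d -mulrBl mulrCA divff ?mulr1// gt_eqF.
have S12 : `|S1 - S2| <= N%:R ^+ 2 * (C / theta * (N%:R^-1 * \sum_(k < N) k.+1%:R^-1)).
  have -> : N%:R ^+ 2 * (C / theta * (N%:R^-1 * \sum_(k < N) k.+1%:R^-1)) =
     N%:R * \sum_(k < N) (C / theta * k.+1%:R^-1).
    rewrite -mulr_sumr; field; by rewrite !gt_eqF.
  have f0 k : 0 <= C / theta * k%:R^-1 by rewrite mulr_ge0 ?divr_ge0 ?invr_ge0// ltW.
  apply: le_trans (sum_pairs_le N f0).
  rewrite /S1 /S2 -sumrB; apply: le_trans (ler_norm_sum _ _ _) _; apply: ler_sum => i _.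
  rewrite -sumrB; apply: le_trans (ler_norm_sum _ _ _) _; apply: ler_sum => j ij.
  have [_ h] := hQ _ (dth _ _ ij (ltn_ord j)); apply: (le_trans h).
  rewrite -mulrA -invfM ler_wpM2l// lef_pV2 ?posrE; last 2 first.
  - exact: lt_le_trans (dth _ _ ij (ltn_ord j)).
  - by rewrite mulr_gt0// ltr0n subn_gt0.
  exact: dge.
have VU : `|\sum_(i < N) U (position theta lam i) - \sum_(i < N) V (position theta lam i)| <= N%:R * e.
  rewrite -sumrB; apply: le_trans (ler_norm_sum _ _ _) _.
  rewrite mulr_natl -[X in _ *+ X]card_ord -sumr_const; apply: ler_sum => i _.
  exact: hU.
have NVU : `|N%:R * (\sum_(i < N) U (position theta lam i) - \sum_(i < N) V (position theta lam i))|
    <= N%:R ^+ 2 * e.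
  by rewrite normrM (gtr0_norm nR) expr2 -mulrA ler_pM2l.
rewrite /config_energy /emp.
move: S2E S12 NVU; clear VU.
set SU := \sum_(i < N) U _; set SV := \sum_(i < N) V _.
set P := \sum_(i < N) \sum_(j < N | _) _; set H := \sum_(i < N) _^-1.
move=> S2E S12 NVU.
have -> : S1 - N%:R * SU - (log_scale N - N%:R ^+ 2 * (N%:R^-1 * SV - 2 * theta / N%:R ^+ 2 * P))
   = (S1 - S2) - N%:R * (SU - SV).
  by rewrite S2E; field; rewrite gt_eqF.
apply: (le_trans (ler_normB _ _)); rewrite [leRHS]mulrDr; exact: lerD.
Qed.

End DiscreteEnergy.

(** * Limits of discrete energies *)

Section EnergyLimit.
Variables (R : realType) (theta : R).
Hypothesis th0 : 0 < theta.

Lemma cvg_inv_nat : (n%:R^-1 : R) @[n --> \oo] --> 0.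
Proof.
by rewrite -(@cvg_shiftS _ (fun n => n%:R^-1 : R)); exact: (@cvg_harmonic R).
Qed.

(** Discrete and continuous energies are compared through the truncated energy
   at a level [eta] fixed in terms of [e], for which convergence of means is
   available. *)
Lemma config_energy_cvg (T : Type) (F : set_system T) {FF : Filter F}
    (N M : T -> nat) (lam : forall k, (N k).-tuple 'I_(M k).+1)
    (b s : R) (chi V : R -> R) :
  0 < b -> 0 <= s <= b -> is_density theta^-1 s chi -> continuous V ->
  N k @[k --> F] --> \oo ->
  (\forall k \near F, lam k \in W (N k) (M k)) ->
  (\forall k \near F, forall i, position theta (lam k) i <= b) ->
  (forall t, mean_cdf (emp theta (lam k)) t @[k --> F] --> mean_cdf (dmean s chi) t) ->
  config_energy theta V (lam k) @[k --> F] --> energy theta V s chi.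
Proof.
move=> b0 /andP[s0 sb] dchi Vc Noo lamW lamb cdf.
have Npos : \forall k \near F, (0 < N k)%N by exact: (Noo _ (nbhs_infty_gt 0)).
have Nlim : (N k)%:R^-1 @[k --> F] --> (0 : R).
  apply: (cvg_comp _ (fun n : nat => n%:R^-1 : R) Noo).
  exact: cvg_inv_nat.
have Lm_ : \forall k \near F, is_mean b (emp theta (lam k)).
  by near=> k; apply: emp_mean => //; [near: k|move=> i _; move: i; near: k].
have Lm := dmean_mean dchi sb.
apply/cvgrPdist_le => e e0.
(* [A eta] is the total cost of truncating: [4 s eta / theta] for the density
   and [2 eta] for the configuration. *)
pose A := 4 * s / theta + 2.
have A0 : 0 < A by rewrite /A ltr_wpDl// divr_ge0 ?mulr_ge0// ltW.
pose eta := e / 4 / A.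
have eta0 : 0 < eta by rewrite !divr_gt0.
have cutc : cut_energy theta eta V (emp theta (lam k)) @[k --> F] -->
    cut_energy theta eta V (dmean s chi).
  rewrite /cut_energy; apply: cvgB; first exact: (mean_cvg b0 Lm_ Lm cdf Vc).
  apply: cvgZr; apply: (@mean2_cvg _ _ _ _ _ _ _ b0 Lm_ Lm cdf _ eta^-1).
  - by rewrite invr_gt0.
  - by move=> x y t; exact: lnmax_lip.
  - by move=> x t t'; rewrite lnmaxC [X in _ - X]lnmaxC; exact: lnmax_lip.
have errc : theta * `|ln eta| / (N k)%:R @[k --> F] --> 0.
  by rewrite -[X in _ --> X](mulr0 (theta * `|ln eta|)); exact: cvgZr.
have e4 : 0 < e / 4 by rewrite divr_gt0.
have en := energy_lnmax V th0 s0 eta0 dchi.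
have eA : theta * (theta^-1 * theta^-1 * (s * (4 * eta))) + 2 * eta = e / 4.
  rewrite -[RHS](divfK (lt0r_neq0 A0)) -/eta mulrC /A.
  by field; rewrite gt_eqF.
near=> k.
have h1 : `|config_energy theta V (lam k) - cut_energy theta eta V (emp theta (lam k))| <=
     theta * `|ln eta| / (N k)%:R + 2 * eta.
  by apply: config_energy_cut => //; near: k.
have h2 : `|cut_energy theta eta V (dmean s chi) - cut_energy theta eta V (emp theta (lam k))| <= e / 4.
  by near: k; exact: (@cvgr_dist_le _ _ _ _ _ _ _ cutc _ e4).
have h3 : `|0 - theta * `|ln eta| / (N k)%:R| <= e / 4.
  by near: k; exact: (@cvgr_dist_le _ _ _ _ _ _ _ errc _ e4).
rewrite sub0r normrN in h3; have h4 := le_trans (ler_norm _) h3.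
rewrite -/(cut_energy theta eta V (dmean s chi)) in en.
move: h1 h2 en h4; rewrite !ler_norml => /andP[? ?] /andP[? ?] /andP[? ?] ?.
by apply/andP; split; lra.
Unshelve. all: by end_near. Qed.

Variables (MN : nat -> nat) (s : R) (s0 : 0 <= s).
Hypothesis MN_cvg : (MN n)%:R / n%:R @[n --> \oo] --> s - theta.

Lemma position_eventually_le t : s < t -> \forall n \near \oo,
  forall (lam : n.-tuple 'I_(MN n).+1) i, position theta lam i <= t.
Proof.
move=> st; near=> n => lam i.
have n0 : (0 < n)%N by near: n; exact: nbhs_infty_gt.
apply: (le_trans (position_le th0 lam i n0)).
have h1 : (MN n)%:R / n%:R <= t - theta.
  by near: n; apply: (cvgr_le _ MN_cvg); lra.
suff : (n%:R - 1) * n%:R^-1 * theta <= theta by lra.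
rewrite ler_piMl ?(ltW th0)// ler_pdivrMr ?ltr0n// mul1r; lra.
Unshelve. all: by end_near. Qed.

Lemma good_configuration (chi V : R -> R) (d : R) :
  is_density theta^-1 s chi -> continuous V -> 0 < d ->
  \forall n \near \oo, exists2 lam : n.-tuple 'I_(MN n).+1, lam \in W n (MN n) &
     config_energy theta V lam <= energy theta V s chi + d.
Proof.
move=> dchi Vc d0.
have hl n : exists lam : n.-tuple 'I_(MN n).+1, (0 < n)%N ->
    lam \in W n (MN n) /\ forall t, `|mean_cdf (emp theta lam) t - mean_cdf (dmean s chi) t| <=
      theta^-1 * ((1 + theta) / n%:R + `|s - theta - (MN n)%:R / n%:R|) + n%:R^-1.
  have [n0|n0] := posnP n; first by exists [tuple of nseq n ord0]; rewrite n0.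
  by have [lam h1 h2] := quantile_configuration th0 s0 dchi (MN n) n0; exists lam.
pose lam n := projT1 (cid (hl n)).
have hlam n (n0 : (0 < n)%N) := projT2 (cid (hl n)) n0.
have cdf t : mean_cdf (emp theta (lam n)) t @[n --> \oo] --> mean_cdf (dmean s chi) t.
  pose r n : R := theta^-1 * ((1 + theta) * n%:R^-1 + `|s - theta - (MN n)%:R / n%:R|) + n%:R^-1.
  have rc : r n @[n --> \oo] --> 0.
    have -> : 0 = theta^-1 * ((1 + theta) * 0 + `|s - theta - (s - theta)|) + 0 :> R.
      by rewrite mulr0 subrr normr0 !addr0 mulr0.
    apply: cvgD cvg_inv_nat; apply: cvgZr; apply: cvgD; first exact: cvgZr cvg_inv_nat.
    by apply: cvg_norm; apply: cvgB MN_cvg; exact: cvg_cst.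
  apply/cvgrPdist_le => e e0; near=> n.
  have n0 : (0 < n)%N by near: n; exact: nbhs_infty_gt.
  rewrite distrC; apply: (le_trans ((hlam n n0).2 t)).
  by near: n; apply: (cvgr_le _ rc).
have s1 : 0 <= s <= s + 1 by rewrite s0/=; lra.
have b0 : 0 < s + 1 by lra.
have lamW : \forall n \near \oo, lam n \in W n (MN n).
  by near=> n; apply: (hlam n _).1; near: n; exact: nbhs_infty_gt.
have lamb : \forall n \near \oo, forall i, position theta (lam n) i <= s + 1.
  have : s < s + 1 by lra.
  by move=> /position_eventually_le; apply: filterS => n; apply.
have ec : config_energy theta V (lam n) @[n --> \oo] --> energy theta V s chi.
  exact: (config_energy_cvg b0 s1 dchi Vc cvg_id lamW lamb cdf).
near=> n; exists (lam n); first by near: n.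
by near: n; apply: (cvgr_le _ ec); lra.
Unshelve. all: by end_near. Qed.

(** A compactness argument: an ultrafilter limit of deviating configurations
   with energies approaching that of [chi0] or below has a density [chi] to
   which the hypothesis on [chi0] applies, although the integrals of [g]
   against [chi] and [chi0] differ by at least [eps]. *)
Lemma energy_gap (chi0 V g : R -> R) (eps : R) : continuous V -> continuous g ->
  (forall chi, is_density theta^-1 s chi ->
     energy theta V s chi <= energy theta V s chi0 -> dmean s chi g = dmean s chi0 g) ->
  0 < eps ->
  exists2 d : R, 0 < d & \forall n \near \oo, forall lam : n.-tuple 'I_(MN n).+1,
    lam \in W n (MN n) -> eps < `|emp theta lam g - dmean s chi0 g| ->
    energy theta V s chi0 + d <= config_energy theta V lam.
Proof.
move=> Vc gc chi0P eps0; apply: contrapT => H.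
have /choice[x hx] : forall k, exists x : {n : nat & n.-tuple 'I_(MN n).+1},
   [/\ (k < projT1 x)%N, projT2 x \in W _ _, eps < `|emp theta (projT2 x) g - dmean s chi0 g| &
     config_energy theta V (projT2 x) <= energy theta V s chi0 + k.+1%:R^-1].
  move=> k; apply: contrapT => h; apply: H; exists k.+1%:R^-1; first by rewrite invr_gt0.
  exists k.+1 => // n /= kn lam lamW lame; rewrite leNgt; apply/negP => /ltW ?.
  by apply: h; exists (existT _ n lam).
pose N k := projT1 (x k); pose lam k : (N k).-tuple 'I_(MN (N k)).+1 := projT2 (x k).
have [U [UU sub]] := @ultraFilterLemma nat \oo _.
have FU : ProperFilter U by exact: ultra_proper.
have Noo : N k @[k --> U] --> \oo.
  apply: cvg_trans (_ : N k @[k --> \oo] --> \oo); first exact: cvg_app.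
  by apply/cvgnyPge => A; exists A => // k /= Ak; have [/ltnW kN _ _ _] := hx k; exact: leq_trans kN.
have lamW k : lam k \in W (N k) (MN (N k)) by have [] := hx k.
have Npos k : (0 < N k)%N by have [/(leq_ltn_trans (leq0n _))] := hx k.
have inv0 (u : nat -> nat) : u k @[k --> U] --> \oo -> (u k)%:R^-1 @[k --> U] --> (0 : R).
  move=> uoo; apply: (cvg_comp _ (fun n : nat => n%:R^-1 : R) uoo).
  exact: cvg_inv_nat.
have lamt t : s < t -> \forall k \near U, forall i, position theta (lam k) i <= t.
  move=> /position_eventually_le h.
  by have := Noo _ h; apply: (@filterS _ U) => k /=; apply.
have th1 : 0 < theta^-1 by rewrite invr_gt0.
have [|||chi dchi cdf] := @ultra_density R nat U UU theta^-1 s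
    (fun k => mean_cdf (emp theta (lam k))) (fun k => (N k)%:R^-1) th1 s0 _ (inv0 _ Noo).
- by move=> a b ab; apply: filterE => k; exact: emp_cdf_lip.
- move=> t t0; apply: filterE => k; rewrite /mean_cdf /emp big1 ?mulr0// => i _.
  suff -> : (position theta (lam k) i <= t) = false by [].
  by apply/negbTE; rewrite -ltNge (lt_le_trans t0)// position_ge0.
- move=> t /lamt; apply: filterS => k hk; rewrite /mean_cdf /emp.
  rewrite (eq_bigr (fun=> 1)); last by move=> i _; rewrite hk.
  by rewrite sumr_const card_ord mulVf// pnatr_eq0 -lt0n.
have s1 : 0 <= s <= s + 1 by rewrite s0/=; lra.
have b0 : 0 < s + 1 by lra.
have lamb : \forall k \near U, forall i, position theta (lam k) i <= s + 1 by apply: lamt; lra.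
have lamWU : \forall k \near U, lam k \in W (N k) (MN (N k)) by exact: filterE.
have ec : config_energy theta V (lam k) @[k --> U] --> energy theta V s chi.
  exact: (config_energy_cvg b0 s1 dchi Vc Noo lamWU lamb cdf).
have ele : energy theta V s chi <= energy theta V s chi0.
  rewrite -[leRHS]addr0.
  have rc : energy theta V s chi0 + k.+1%:R^-1 @[k --> U] --> energy theta V s chi0 + 0.
    apply: cvgD; first exact: cvg_cst.
    apply: inv0; apply: cvg_trans (_ : k.+1 @[k --> \oo] --> \oo); first exact: cvg_app.
    by apply/cvgnyPge => A; exists A => // k /= /leqW.
  have dc : (energy theta V s chi0 + k.+1%:R^-1 - config_energy theta V (lam k)) @[k --> U] -->
      energy theta V s chi0 + 0 - energy theta V s chi by exact: (cvgB rc ec).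
  rewrite -subr_ge0; apply: (cvgr_to_ge dc).
  by apply: filterE => k; rewrite subr_ge0; have [] := hx k.
have gE := chi0P _ dchi ele.
have mc : emp theta (lam k) g @[k --> U] --> dmean s chi g.
  apply: (@mean_cvg _ _ _ _ (s + 1) _ _ b0 _ _ cdf _ gc).
  - near=> k; apply: emp_mean => // i _; move: i; near: k; exact: lamb.
  - by apply: (dmean_mean dchi); lra.
have : \forall k \near U, `|emp theta (lam k) g - dmean s chi0 g| < eps.
  rewrite -gE; have h : \forall k \near U, `|dmean s chi g - emp theta (lam k) g| < eps.
    exact: (@cvgr_dist_lt _ _ _ _ _ _ _ mc _ eps0).
  by near=> k; rewrite distrC; near: k.
move=> /filter_ex[k]; have [_ _ h _] := hx k.
by move=> /(lt_trans h); rewrite ltxx.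
Unshelve. all: by end_near. Qed.

End EnergyLimit.

(** * The large deviation bound *)

Section Probabilities.
Variables (R : realType) (theta : R).

Lemma Pr_ge0 (U : R -> R) N M (E : pred (N.-tuple 'I_M.+1)) :
  (forall lam, lam \in W N M -> 0 < weight theta U lam) -> 0 <= Pr theta U E.
Proof.
move=> w0; rewrite /Pr sumr_ge0// => lam /andP[lamW _].
apply: divr_ge0; first exact/ltW/w0.
by apply: sumr_ge0 => l lW; exact/ltW/w0.
Qed.

(** The normalization constant is at least the weight of one well chosen
   configuration [lam0]. *)
Lemma Pr_le (U : R -> R) N M (E : pred (N.-tuple 'I_M.+1)) (lam0 : N.-tuple 'I_M.+1) (r : R) :
  (forall lam, lam \in W N M -> 0 < weight theta U lam) -> lam0 \in W N M ->
  0 <= r ->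
  (forall lam, lam \in W N M -> E lam -> weight theta U lam <= r * weight theta U lam0) ->
  Pr theta U E <= M.+1%:R ^+ N * r.
Proof.
move=> w0 lam0W r0 hE.
have Z0 : weight theta U lam0 <= Z theta U N M.
  rewrite /Z (bigD1 lam0)//= lerDl sumr_ge0// => lam /andP[lamW _].
  by rewrite ltW ?w0.
have Zp : 0 < Z theta U N M by apply: lt_le_trans Z0; exact: w0.
have -> : M.+1%:R ^+ N * r = \sum_(lam : N.-tuple 'I_M.+1) r.
  by rewrite sumr_const card_tuple card_ord -natrX mulr_natl.
rewrite /Pr big_mkcond/=; apply: ler_sum => lam _; case: ifP => // /andP[lamW lamE].
rewrite ler_pdivrMr//; apply: (le_trans (hE _ lamW lamE)).
by rewrite ler_wpM2l.
Qed.

(** The factor [exp (- d n ^ 2)] beats the number of configurations, which is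
   only exponential in [n ln n]. *)
Lemma entropy_bound (m : nat -> nat) (c d : R) : 0 < d ->
  (\forall n \near \oo, (m n)%:R / n%:R <= c) ->
  (fun n => (m n).+1%:R ^+ n * expR (- (d * n%:R ^+ 2))) @ \oo --> 0.
Proof.
move=> d0 mc.
have e1 : `|expR (-1)| < 1 :> R by rewrite ger0_norm ?expR_ge0// expR_lt1// ltrN10.
apply: squeeze_cvgr (cvg_cst 0) (cvg_expr e1).
near=> n.
have n0 : (0 < n)%N by near: n; exact: nbhs_infty_gt.
have nR : 0 < n%:R :> R by rewrite ltr0n.
rewrite mulr_ge0 ?exprn_ge0 ?expR_ge0//=.
have -> : expR (- (d * n%:R ^+ 2)) = expR (- (d * n%:R)) ^+ n.
  by rewrite -expRM_natr; congr expR; ring.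
rewrite -exprMn lerXn2r ?nnegrE ?mulr_ge0 ?expR_ge0//.
have mn : (m n)%:R <= c * n%:R.
  by rewrite -ler_pdivrMr//; near: n.
have n1 : 2 / d <= n%:R by near: n; exact: nbhs_infty_ger.
have n2 : 8 * c / d ^+ 2 <= n%:R by near: n; exact: nbhs_infty_ger.
rewrite expRN ler_pdivrMr ?expR_gt0// -expRD addrC.
have dn : 2 <= d * n%:R by rewrite mulrC -ler_pdivrMr.
have dn1 : 0 <= d * n%:R - 1 by lra.
apply: le_trans (expR_ge1Dxn 1 dn1).
rewrite -natr1 addrC lerD2l; apply: (le_trans mn).
rewrite ler_pdivrMr ?exprn_gt0// in n2.
have h3 : 8 * c * n%:R <= n%:R * d ^+ 2 * n%:R by rewrite ler_pM2r.
have -> : 2`!%:R = 2 :> R by [].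
nra.
Unshelve. all: by end_near. Qed.

End Probabilities.

(** * The convergence of the empirical measures *)

Section Empirical.
Variables (R : realType) (theta : R).
Hypothesis th0 : 0 < theta.

Lemma empirical_Rintegral N M (lam : N.-tuple 'I_M.+1) (f : R -> R) : (0 < N)%N ->
  measurable_fun setT f ->
  \int[empirical theta lam]_(x in `[0%R, +oo[) f x = emp theta lam f.
Proof.
move=> N0 mf; have mf' : measurable_fun (`[0%R, +oo[%classic : set R) f by exact: measurable_funS mf.
have pos (g : R -> R) : measurable_fun (`[0%R, +oo[%classic : set R) g -> (forall x, 0 <= g x) ->
    (\int[empirical theta lam]_(x in `[0%R, +oo[) (g x)%:E)%E = (emp theta lam g)%:E.
  move=> mg g0; have mg' : measurable_fun (`[0%R, +oo[%classic : set R) (EFin \o g) by exact/measurable_EFinP.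
  have g0' x : `[0%R, +oo[%classic x -> (0 <= (g x)%:E)%E by rewrite lee_fin.
  rewrite /empirical ge0_integral_mscale// ge0_integral_measure_sum//.
  rewrite (eq_bigr (fun i : 'I_N => (g (position theta lam i))%:E)); last first.
    move=> i _; rewrite integral_dirac// diracE mem_set ?mul1e//=.
    by rewrite in_itv/= andbT position_ge0.
  by rewrite sumEFin -EFinM.
rewrite /Rintegral integralE.
transitivity (fine ((emp theta lam (fun x => Num.max (f x) 0))%:E -
   (emp theta lam (fun x => Num.max (- f x) 0))%:E)).
  congr (fine (_ - _)); rewrite -pos.
  - by apply: eq_integral => x _; rewrite funeposE EFin_max.
  - exact: measurable_maxr.
  - by move=> x; rewrite le_max lexx orbT.
  - by apply: eq_integral => x _; rewrite funenegE EFin_max.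
  - by apply: measurable_maxr => //; exact: measurableT_comp.
  - by move=> x; rewrite le_max lexx orbT.
rewrite -EFinB/= /emp -mulrBr -sumrB; congr (_ * _); apply: eq_bigr => i _.
by case: (leP (f (position theta lam i)) 0) => h; rewrite /Num.max; case: ltP; lra.
Qed.

(** Used to extend functions that are continuous on a closed interval to
   continuous functions on the line. *)
Lemma clamp_continuous (A : set R) (r f : R -> R) : {within A, continuous f} ->
  continuous r -> (forall x, A (r x)) -> continuous (f \o r).
Proof.
move=> fc rc Ar x B fB.
have := fc (r x) B fB; rewrite /nbhs/= -nbhs_subspace_in//.
rewrite /nbhs/= => h.
by have := rc x _ h; apply: (@filterS _ (nbhs x)) => y /=; apply; exact: Ar.
Qed.

Lemma max0_continuous : continuous (fun x : R => Num.max x 0).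
Proof.
apply: (@lip_continuous _ _ 1) => x y; rewrite mul1r.
have := ler_norm (x - y); have := ler_norm (y - x); rewrite distrC.
have := normr_ge0 (x - y).
by rewrite /Num.max; case: ifPn => h1; case: ifPn => h2; rewrite ler_norml; lra.
Qed.

Lemma min_continuous (s : R) : continuous (fun x : R => Num.min x s).
Proof.
apply: (@lip_continuous _ _ 1) => x y; rewrite mul1r.
have := ler_norm (x - y); have := ler_norm (y - x); rewrite distrC.
have := normr_ge0 (x - y).
by rewrite /Num.min; case: ifPn => h1; case: ifPn => h2; rewrite ler_norml; lra.
Qed.

End Empirical.

Lemma eq_energy (R : realType) (theta s : R) (V V' psi : R -> R) :
  (forall x, x \in `[0%R, s] -> V x = V' x) ->
  energy theta V s psi = energy theta V' s psi.
Proof.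
move=> VV; congr (_ + _); apply: eq_Rintegral => x; rewrite inE => /VV.
by move=> /= ->.
Qed.

Section LargeDeviation.
Variables (R : realType) (theta s : R) (MN : nat -> nat) (VN : nat -> R -> R)
  (V g chi0 : R -> R) (e : nat -> R).
Hypotheses (th0 : 0 < theta) (s0 : 0 <= s).
Hypothesis MN_cvg : (MN n)%:R / n%:R @[n --> \oo] --> s - theta.
Hypotheses (V_cont : continuous V) (g_cont : continuous g).
Hypothesis VN_V : forall n, (0 < n)%N -> forall (lam : n.-tuple 'I_(MN n).+1) i,
  `|VN n (position theta lam i) - V (position theta lam i)| <= e n.
Hypothesis e_cvg : e n @[n --> \oo] --> 0.
Hypothesis dchi0 : is_density theta^-1 s chi0.
Hypothesis chi0_min : forall chi, is_density theta^-1 s chi ->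
  energy theta V s chi <= energy theta V s chi0 -> dmean s chi g = dmean s chi0 g.

(** A deviating configuration loses [d] in energy against the minimum, a well
   chosen one only [d / 4], and each weight is known up to [exp (n ^ 2 d / 8)];
   a factor [exp (- n ^ 2 d / 2)] remains. *)
Lemma Pr_deviation (eps : R) : 0 < eps ->
  (fun n => Pr theta (VN n) (fun lam : n.-tuple 'I_(MN n).+1 =>
     eps < `|emp theta lam g - dmean s chi0 g|)) @ \oo --> 0.
Proof.
move=> eps0.
have [d d0 gap] := energy_gap th0 s0 MN_cvg V_cont g_cont chi0_min eps0.
have [C C0 hw] := weight_energy th0.
pose err n := C * (n%:R^-1 * \sum_(k < n) k.+1%:R^-1) + e n.
have errc : err n @[n --> \oo] --> 0.
  have -> : 0 = C * 0 + 0 :> R by rewrite mulr0 addr0.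
  apply: cvgD e_cvg; apply: cvgZr.
  rewrite -(@cvg_shiftS _ (fun n => n%:R^-1 * \sum_(k < n) k.+1%:R^-1 : R)).
  suff -> : (fun n => n.+1%:R^-1 * \sum_(k < n.+1) k.+1%:R^-1 : R) = arithmetic_mean harmonic.
    exact: cesaro (@cvg_harmonic R).
  by apply/funext => n; rewrite /arithmetic_mean /series/= big_mkord.
have mb : \forall n \near \oo, (MN n)%:R / n%:R <= s - theta + 1 by apply: (cvgr_le _ MN_cvg); lra.
have d2 : 0 < d / 2 by rewrite divr_gt0.
apply: squeeze_cvgr (cvg_cst 0) (entropy_bound d2 mb).
have d4 : 0 < d / 4 by rewrite divr_gt0.
have good := good_configuration th0 s0 MN_cvg dchi0 V_cont d4.
near=> n.
have n0 : (0 < n)%N by near: n; exact: nbhs_infty_gt.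
have n2 : 0 < n%:R ^+ 2 :> R by rewrite exprn_gt0// ltr0n.
have wE (lam : n.-tuple 'I_(MN n).+1) : lam \in W n (MN n) -> 0 < weight theta (VN n) lam /\
    `|ln (weight theta (VN n) lam) - (log_scale theta n - n%:R ^+ 2 * config_energy theta V lam)| <=
      n%:R ^+ 2 * err n.
  by move=> lamW; apply: hw => // i _; exact: VN_V.
have wp lam (lamW : lam \in W n (MN n)) := (wE lam lamW).1.
rewrite Pr_ge0//=.
have [lam0 lam0W lam0E] : exists2 lam : n.-tuple 'I_(MN n).+1, lam \in W n (MN n) &
     config_energy theta V lam <= energy theta V s chi0 + d / 4 by near: n.
apply: (Pr_le wp lam0W) => [|lam lamW lame]; first exact: expR_ge0.
have lamE : energy theta V s chi0 + d <= config_energy theta V lam.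
  by move: lam lamW lame; near: n.
have w0 := wp _ lam0W; have w1 := wp _ lamW.
rewrite -ler_ln ?posrE//; last exact: mulr_gt0 (expR_gt0 _) w0.
rewrite lnM ?posrE ?expR_gt0// expRK.
have er : err n <= d / 8 by near: n; apply: (cvgr_le _ errc); rewrite divr_gt0.
have [_ h1] := wE _ lamW; have [_ h0] := wE _ lam0W.
have er2 : n%:R ^+ 2 * err n <= n%:R ^+ 2 * (d / 8) by rewrite ler_pM2l.
have l1 : n%:R ^+ 2 * (energy theta V s chi0 + d) <= n%:R ^+ 2 * config_energy theta V lam.
  by rewrite ler_pM2l.
have l0 : n%:R ^+ 2 * config_energy theta V lam0 <= n%:R ^+ 2 * (energy theta V s chi0 + d / 4).
  by rewrite ler_pM2l.
move: h1 h0; rewrite !ler_norml => /andP[_ h1] /andP[h0 _].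
rewrite mulrDr in l1; rewrite [leRHS]mulrDr in l0.
have e1 : n%:R ^+ 2 * (d / 8) = n%:R ^+ 2 * d / 8 by rewrite mulrA.
have e2 : n%:R ^+ 2 * (d / 4) = n%:R ^+ 2 * d / 4 by rewrite mulrA.
have e3 : d / 2 * n%:R ^+ 2 = n%:R ^+ 2 * d / 2 by rewrite mulrC mulrA.
rewrite e1 in er2; rewrite e2 in l0; rewrite e3; lra.
Unshelve. all: by end_near. Qed.

End LargeDeviation.

Theorem proposition4p1 (R : realType)
  (theta a0 A0 A1 A2 A3 A4 M : R)
  (MN : nat -> nat) (q p : nat -> R) (VN : nat -> R -> R) (V : R -> R)
  (phi : R -> R)
  (theta_gt0 : 0 < theta) (a0_gt0 : 0 < a0) (a0_le_A0 : a0 <= A0)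
  (M_bounds : a0 <= M <= A0)
  (A1_gt0 : 0 < A1) (A2_gt0 : 0 < A2) (A3_gt0 : 0 < A3) (A4_gt0 : 0 < A4)
  (q_bounds : forall N, (0 < N)%N -> 0 <= q N <= 1)
  (MN_M : forall N, (0 < N)%N ->
     `|N%:R^-1 * (MN N)%:R - M| <= A1 * q N)
  (VN_cont : forall N, (0 < N)%N ->
     {within `[0, (MN N)%:R * N%:R^-1 + (N%:R - 1) * N%:R^-1 * theta],
       continuous (VN N)})
  (V_cont : {within `[0, M + theta], continuous V})
  (V_ext : forall x : R, M + theta <= x -> V x = V (M + theta))
  (p_ge0 : forall N, (0 < N)%N -> 0 <= p N)
  (VN_V : forall N, (0 < N)%N -> forall s : R,
     s \in `[0, (MN N)%:R * N%:R^-1 + (N%:R - 1) * N%:R^-1 * theta] ->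
     `|VN N s - V s| <= A2 * p N)
  (V_bounded : forall s : R, s \in `[0, M + theta] -> `|V s| <= A3)
  (V_deriv : forall s : R, s \in `]0, M + theta[ ->
     derivable V s 1 /\
     `|derive1 V s| <= A4 * (1 + `|ln `|s| | + `|ln `|s - M - theta| |))
  (phi_min : unique_minimizer theta V (M + theta) phi)
  (p_cvg : p @ \oo --> 0) (q_cvg : q @ \oo --> 0) :
  forall f : R -> R,
    {within `[0, +oo[, continuous f} ->
    (exists C : R, forall x : R, 0 <= x -> `|f x| <= C) ->
  forall eps : R, 0 < eps ->
    (fun N : nat => Pr theta (VN N) (fun lam : N.-tuple 'I_(MN N).+1 =>
       eps < `| \int[empirical theta lam]_(x in `[0%R, +oo[) f x
              - \int[lebesgue_measure]_(x in `[0%R, +oo[)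
                  (f x * patch (fun=> 0) `[0%R, M + theta] phi x) |))
      @ \oo --> 0.
Proof.
move=> f f_cont _ eps eps0.
set s := M + theta in phi_min *.
have [M0 _] := andP M_bounds.
have s_gt0 : 0 < s by rewrite addr_gt0// (lt_le_trans a0_gt0).
have s0 := ltW s_gt0.
(* Only the values on [[0, +oo[] matter, so [V] and [f] may be replaced by
   functions that are continuous on the whole line. *)
pose Vh x := V (Num.min (Num.max x 0) s).
pose fh x := f (Num.max x 0).
have Vh_cont : continuous Vh.
  apply: (@clamp_continuous _ `[0, s]%classic (fun x => Num.min (Num.max x 0) s)) => //.
    move=> x; apply: (@continuous_comp _ _ _ (fun x : R => Num.max x 0) (fun x => Num.min x s)).
      exact: max0_continuous.
    exact: min_continuous.
  by move=> x /=; rewrite in_itv/= le_min le_max lexx orbT s0 ge_min lexx orbT.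
have fh_cont : continuous fh.
  apply: (@clamp_continuous _ `[0, +oo[%classic (fun x => Num.max x 0)) => //.
    exact: max0_continuous.
  by move=> x /=; rewrite in_itv/= andbT le_max lexx orbT.
have VhE x : 0 <= x -> V x = Vh x.
  move=> x0; rewrite /Vh (max_l x0); case: (leP x s) => // /ltW sx.
  by rewrite V_ext.
have fhE x : 0 <= x -> f x = fh x by move=> x0; rewrite /fh (max_l x0).
have VhE' x : x \in `[0, s] -> V x = Vh x by rewrite in_itv/= => /andP[/VhE].
have [adm opt] := phi_min.
pose chi0 := trunc_density theta s phi.
have dchi0 : is_density theta^-1 s chi0 by exact: trunc_density_density.
have [mVh _] := locbm_continuous s Vh_cont; have [mfh _] := locbm_continuous s fh_cont.
have e0E : energy theta V s phi = energy theta Vh s chi0.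
  by rewrite (eq_energy _ _ VhE') (trunc_density_energy adm)//; exact: measurable_funS mVh.
have fphi : \int[lebesgue_measure]_(x in `[0%R, s]) (fh x * phi x) = dmean s chi0 fh.
  by rewrite (trunc_density_int adm)//; exact: measurable_funS mfh.
have chi0_min chi : is_density theta^-1 s chi ->
    energy theta Vh s chi <= energy theta Vh s chi0 -> dmean s chi fh = dmean s chi0 fh.
  move=> dchi ele; have admc := density_admissible s0 dchi.
  have [le1 uniq] := opt _ admc.
  have eqc : energy theta V s chi = energy theta V s phi.
    apply/eqP; rewrite eq_le le1 andbT e0E (eq_energy _ _ VhE').
    exact: ele.
  have ae := uniq eqc.
  rewrite -fphi /dmean /Rintegral; congr fine; apply: ae_eq_integral => //.
  - have [mchi _ _ _] := dchi.
    by apply/measurable_EFinP; apply: measurable_funM; [exact: measurable_funS mfh|exact: measurable_funS mchi].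
  - have [/measurable_int/measurable_EFinP mphi _ _] := adm.
    by apply/measurable_EFinP; apply: measurable_funM => //; exact: measurable_funS mfh.
  - have [A [mA A00 hA]] := ae; exists A; split => // x /= h; apply: hA => /= hx.
    by apply: h => /hx ->.
have MN_cvg : (MN n)%:R / n%:R @[n --> \oo] --> s - theta.
  have -> : s - theta = M by rewrite /s addrK.
  have qc : A1 * q n @[n --> \oo] --> 0.
    by rewrite -[X in _ --> X](mulr0 A1); exact: cvgZr.
  apply/cvgrPdist_le => e e0; near=> n.
  have n0 : (0 < n)%N by near: n; exact: nbhs_infty_gt.
  rewrite distrC mulrC; apply: (le_trans (MN_M n n0)).
  by near: n; apply: (cvgr_le _ qc).
have e_cvg : A2 * p n @[n --> \oo] --> 0.
  by rewrite -[X in _ --> X](mulr0 A2); exact: cvgZr.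
have VNVh n : (0 < n)%N -> forall (lam : n.-tuple 'I_(MN n).+1) i,
    `|VN n (position theta lam i) - Vh (position theta lam i)| <= A2 * p n.
  move=> n0 lam i; have x0 := position_ge0 theta_gt0 lam i.
  by rewrite -VhE//; apply: VN_V => //; rewrite in_itv/= x0 position_le.
have intE : \int[lebesgue_measure]_(x in `[0%R, +oo[) (f x * patch (fun=> 0) `[0%R, s] phi x)
    = dmean s chi0 fh.
  rewrite -fphi.
  have sE : `[0, s]%classic = `[0, +oo[ `&` `[0, s] :> set R.
    by apply/seteqP; split => x /=; rewrite !in_itv/= ?andbT; [move=> /[dup]/andP[]|case].
  rewrite [in RHS]sE Rintegral_mkcondr; apply: eq_Rintegral => x; rewrite inE/= in_itv/= andbT => x0.
  by rewrite !patchE; case: ifP => _; rewrite ?mulr0// fhE.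
have empE n (lam : n.-tuple 'I_(MN n).+1) : (0 < n)%N ->
    \int[empirical theta lam]_(x in `[0%R, +oo[) f x = emp theta lam fh.
  move=> n0; rewrite -empirical_Rintegral//; apply: eq_Rintegral => x.
  by rewrite inE/= in_itv/= andbT => /fhE.
have := Pr_deviation theta_gt0 s0 MN_cvg Vh_cont fh_cont VNVh e_cvg dchi0 chi0_min eps0.
apply: cvg_trans; apply: near_eq_cvg; near=> n.
have n0 : (0 < n)%N by near: n; exact: nbhs_infty_gt.
rewrite intE /Pr; apply: eq_bigl => lam; by rewrite empE.
Unshelve. all: by end_near. Qed.
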